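(* For every $\Delta\in\mathbb N$ there exists a positive constant $C$ such that the following holds for every sufficiently large $d\in\mathbb N$. If $G$ is an $(n,d,\lambda)$-graph with $d/\lambda\ge C$, then the square $G^2$ contains a copy of every $n$-vertex tree with maximum degree at most $\Delta$.
   Context: An $(n,d,\lambda)$-graph is an $n$-vertex $d$-regular graph such that every eigenvalue of its adjacency matrix other than the largest one (which equals $d$) has absolute value at most $\lambda$. The square $G^2$ of a graph $G$ is the graph on $V(G)$ obtained from $G$ by adding an edge between every pair of vertices at distance $2$ in $G$. ''Sufficiently large $d$'' means: there exists $d_0=d_0(\Delta)$ such that the statement holds for all $d\ge d_0$ (with $C$ fixed). *)

(* Defs.v *)
From HB Require Import structures.
From mathcomp Require Import all_boot all_order all_algebra.
From mathcomp Require Import reals.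

Set Implicit Arguments.
Unset Strict Implicit.
Unset Printing Implicit Defensive.

Import Order.TTheory GRing.Theory Num.Theory.
Local Open Scope ring_scope.

Record sgraph := SGraph {
  vertex :> finType;
  adj : rel vertex;
  adj_sym : symmetric adj;
  adj_irr : irreflexive adj
}.

Definition degree (G : sgraph) (x : G) : nat := #|[set y | adj x y]|.

Definition max_degree (G : sgraph) : nat := (\max_(x : G) degree x)%N.

Definition regular (G : sgraph) (d : nat) : Prop := forall x : G, degree x = d.

Definition adj_mx (R : realType) (G : sgraph) : 'M[R]_#|G| :=
  \matrix_(i, j) (adj (enum_val i) (enum_val j))%:R.

(* The list of eigenvalues, repeated with multiplicity, in nonincreasing order.
   A symmetric real matrix always has exactly one such list. *)
Definition spectrum (R : realType) (n : nat) (A : 'M[R]_n) (s : seq R) : Prop :=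
  sorted >=%R s /\ char_poly A = \prod_(a <- s) ('X - a%:P).

(* Only one copy of the largest eigenvalue d is dropped: if d has multiplicity
   at least 2 (G disconnected), then lambda must be at least d. *)
Definition ndl_graph (R : realType) (n d : nat) (lambda : R) (G : sgraph) :
    Prop :=
  [/\ #|G| = n, regular G d &
      exists2 s : seq R, spectrum (adj_mx R G) s &
        forall a, a \in behead s -> `|a| <= lambda].

Definition has_walk (G : sgraph) (k : nat) (x y : G) : bool :=
  [exists p : k.-tuple G, path (@adj G) x p && (last x p == y)].

Definition at_distance (G : sgraph) (k : nat) (x y : G) : bool :=
  has_walk k x y && [forall j : 'I_k, ~~ has_walk j x y].

Definition square_adj (G : sgraph) : rel G :=
  fun x y => adj x y || at_distance 2 x y.

Lemma has_walk_sym (G : sgraph) (k : nat) (x y : G) :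
  has_walk k x y = has_walk k y x.
Proof.
suff H : forall u v : G, has_walk k u v -> has_walk k v u
  by apply/idP/idP; apply: H.
move=> u v /existsP[p /andP[Hp /eqP Hl]].
have sz : size (rev (belast u p)) == k by rewrite size_rev size_belast size_tuple.
apply/existsP; exists (Tuple sz) => /=; rewrite -Hl; apply/andP; split.
  rewrite rev_path; move: Hp; congr is_true.
  by apply: eq_path => a b; rewrite adj_sym.
by case: (p : seq G) => //= b q; rewrite rev_cons last_rcons.
Qed.

Lemma square_adj_sym (G : sgraph) : symmetric (@square_adj G).
Proof.
move=> x y; rewrite /square_adj /at_distance adj_sym has_walk_sym.
by congr (_ || (_ && _)); apply: eq_forallb => j; rewrite has_walk_sym.
Qed.

Lemma square_adj_irr (G : sgraph) : irreflexive (@square_adj G).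
Proof.
move=> x; rewrite /square_adj adj_irr /=; apply/negP => /andP[_ /forallP].
move=> /(_ ord0) /existsP; apply.
by exists [tuple] => /=.
Qed.

Definition square (G : sgraph) : sgraph :=
  SGraph (@square_adj_sym G) (@square_adj_irr G).

Definition connected (G : sgraph) : Prop :=
  (0 < #|G|)%N /\ forall x y : G, connect (@adj G) x y.

(* A sequence of two adjacent vertices is a ucycle, hence the length bound. *)
Definition acyclic (G : sgraph) : Prop :=
  forall c : seq G, (2 < size c)%N -> ~ ucycle (@adj G) c.

Definition is_tree (G : sgraph) : Prop := connected G /\ acyclic G.

(* H contains a copy of F as a (not necessarily induced) subgraph. *)
Definition contains_copy (H F : sgraph) : Prop :=
  exists2 f : F -> H, injective f & forall x y : F, adj x y -> adj (f x) (f y).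

(* Main.v *)
Require Import Defs.
From HB Require Import structures.
From mathcomp Require Import all_boot all_order all_algebra.
From mathcomp Require Import reals.
From mathcomp Require Import complex.
From mathcomp Require Import zify lra ring.

Set Implicit Arguments.
Unset Strict Implicit.
Unset Printing Implicit Defensive.

(** The eigenvalue condition gives [|N(X)| >= t^2 n |X| / (n + t^2 |X|)] with
    [t = d / lambda], hence large expansion of small sets, and an edge between
    any two sets of [m ~ n / t] vertices.

    The tree [T] is first replaced by a tree [Z] on the same vertices with
    [T] contained in [Z^2]: on many disjoint vertical paths of [T] the vertices
    are reordered in zigzag, which turns the path into a pendant path of [Z]
    whose last but one vertex carries a leaf.  For every scale [s] there are
    about [n / K^s] such pendant paths of length about [2 s], [K] depending on
    the maximum degree only.  It then suffices to find [Z] as a spanning tree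
    of [G].

    Trees are grown in [G] vertex by vertex in the manner of Friedman and
    Pippenger, keeping the unused vertices expanding.  Before anything is
    embedded, a set [A] of [O(m)] vertices is set aside such that [A]
    contains [|Y|] neighbours of each small set [Y].  After the bulk of [Z] has
    been embedded, the pendant paths are used to link the tree to all vertices
    of [A]: paths of scale [s] reach all but [m / g^s] of them, where the growth
    rate [g] is much larger than [K].  Once every vertex of [A] carries a
    missing leaf of [Z], Hall's theorem matches the missing leaves with the
    unused vertices: [A] takes care of the small sets of unused vertices, and
    the Friedman-Pippenger condition of the small sets of leaves. *)

(** * Tight sets and Hall's theorem *)

(** A single length of pendant paths would not do. Trees of depth [s] grown from [N] vertices on
    either side are sure to be joined by an edge only if [N * g ^ s >= m], and it cannot be
    prescribed which pair gets linked. So paths of scale [s] serve as long as about [g ^ (S - s)]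
    vertices of [A] are unreached, where [g ^ S] is about [m]. The last vertex of [A] needs length
    about [2 * S], of order [log n], and the guaranteed number [n / K ^ S] of disjoint vertical
    paths of that length may fall below [#|A|]. Stage [s] needs only about [g ^ (S + 1 - s)] paths,
    and all of these fit into the tree once [g ^ S] is a small fraction of [n].

    The square enters through the shape of [Z] alone: an inner path of [T] has two ends tied to the
    rest of the tree, whereas the end of a pendant path may be put on any vertex of [A]. *)

Section TightSets.

Variables (I W : finType) (N : I -> {set W}).

Definition nbhd (X : {set I}) : {set W} := \bigcup_(i in X) N i.

Lemma nbhdP (X : {set I}) w :
  reflect (exists2 i, i \in X & w \in N i) (w \in nbhd X).
Proof. exact: bigcupP. Qed.

Lemma nbhdU (X Y : {set I}) : nbhd (X :|: Y) = nbhd X :|: nbhd Y.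
Proof. exact: bigcup_setU. Qed.

Lemma nbhdS (X Y : {set I}) : X \subset Y -> nbhd X \subset nbhd Y.
Proof. by move=> sXY; rewrite -(setUidPr sXY) nbhdU subsetUl. Qed.

Lemma nbhd1 i : nbhd [set i] = N i.
Proof. exact: big_set1. Qed.

Variables (f : I -> nat) (m : nat).

Hypothesis expand : forall X : {set I}, #|X| <= m.*2 ->
  \sum_(i in X) f i <= #|nbhd X|.
Hypothesis expand_large : forall X : {set I}, m <= #|X| -> #|X| <= m.*2 ->
  \sum_(i in X) f i < #|nbhd X|.

Let tight (X : {set I}) :=
  (#|X| < m) && (\sum_(i in X) f i == #|nbhd X|).

(* Submodularity of [#|nbhd X|] makes tight sets closed under union, and
   [expand_large] keeps the union small enough for [expand] to apply. *)
Let tightU (X Y : {set I}) : tight X -> tight Y -> tight (X :|: Y).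
Proof.
move=> /andP[sX /eqP tX] /andP[sY /eqP tY].
have szU : #|X :|: Y| <= m.*2 by have := cardsUI X Y; lia.
have sum_UI : \sum_(i in X :|: Y) f i + \sum_(i in X :&: Y) f i
            = \sum_(i in X) f i + \sum_(i in Y) f i.
  have -> : \sum_(i in X) f i =
      \sum_(i in X :&: Y) f i + \sum_(i in X :\: Y) f i by rewrite -big_setID.
  have -> : \sum_(i in X :|: Y) f i =
      \sum_(i in Y) f i + \sum_(i in X :\: Y) f i.
    rewrite (big_setID Y) /=; congr (_ + _); apply: eq_bigl => i;
      by rewrite !inE; case: (i \in X); case: (i \in Y).
  lia.
have sub_I : nbhd (X :&: Y) \subset nbhd X :&: nbhd Y.
  by rewrite subsetI !nbhdS ?subsetIl ?subsetIr.
have eI : \sum_(i in X :&: Y) f i <= #|nbhd (X :&: Y)|.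
  apply: expand; apply: (leq_trans (subset_leq_card (subsetIl _ _))); lia.
have eU := expand szU.
have cI := subset_leq_card sub_I.
have cUI := cardsUI (nbhd X) (nbhd Y).
have tU : \sum_(i in X :|: Y) f i = #|nbhd (X :|: Y)|.
  move: eU; rewrite nbhdU; lia.
rewrite /tight tU eqxx andbT ltnNge; apply/negP => /expand_large/(_ szU).
by rewrite tU ltnn.
Qed.

(** If every [w] in [N v] fails, a set violating the conclusion for [w] is tight, avoids [v] and has
    [w] in its neighbourhood. The union [X] of these sets is tight, hence has fewer than [m]
    elements, and [v |: X] has the neighbourhood of [X] but a larger demand, against [expand]. *)
Lemma tight_extend v : 0 < m -> 0 < f v ->
  exists2 w, w \in N v & forall X : {set I}, #|X| <= m.*2 ->
    \sum_(i in X) f i - (v \in X) <= #|nbhd X :\ w|.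
Proof.
move=> m_gt0 fv_gt0.
case: (boolP [exists w in N v, [forall X : {set I}, (#|X| <= m.*2) ==>
    (\sum_(i in X) f i - (v \in X) <= #|nbhd X :\ w|)]]).
  case/exists_inP => w wN /forallP wP; exists w => // X sX.
  by have /implyP := wP X; apply.
rewrite negb_exists_in => /forall_inP none.
suff [X /andP[tX vX] sNX] : exists2 X, tight X && (v \notin X) &
    N v \subset nbhd X.
  have /andP[sX /eqP eX] := tX.
  have := @expand (v |: X); rewrite cardsU1 vX (big_setU1 _ vX) /= => /(_ _).
  by rewrite nbhdU nbhd1 (setUidPr sNX) -eX => H; have : false by lia.
suff H : forall s : seq W, {subset s <= N v} ->
    exists2 X, tight X && (v \notin X) & {subset s <= nbhd X}.
  have [] := H (enum (N v)); first by move=> w; rewrite mem_enum.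
  move=> X tX sX; exists X => //; apply/subsetP => w wN.
  by apply: sX; rewrite mem_enum.
elim=> [|w s IHs] sub.
  exists set0 => //; rewrite inE andbT /tight cards0 m_gt0 /=.
  by rewrite big_set0 /nbhd big_set0 cards0.
have [|X /andP[tX vX] sX] := IHs.
  by move=> z zs; apply: sub; rewrite inE zs orbT.
have /none /forallPn[Y] : w \in N v by apply: sub; rewrite inE eqxx.
rewrite negb_imply -ltnNge => /andP[sY ltY].
have eY := expand sY.
have wY : w \in nbhd Y.
  apply: contraLR ltY => wY; rewrite -leqNgt (leq_trans (leq_subr _ _)) //.
  suff -> : nbhd Y :\ w = nbhd Y by [].
  by apply/setDidPl; rewrite disjoint_sym disjoints1.
move: ltY; rewrite [#|nbhd Y|](cardsD1 w) wY in eY * => ltY.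
have vY : v \notin Y by apply/negP => vY; move: ltY; rewrite vY; lia.
rewrite (negPf vY) in ltY.
have tY : tight Y.
  have eqY : \sum_(i in Y) f i = #|nbhd Y| by rewrite [RHS](cardsD1 w) wY; lia.
  rewrite /tight eqY eqxx andbT ltnNge; apply/negP => /expand_large/(_ sY).
  by rewrite eqY ltnn.
exists (X :|: Y); first by rewrite tightU // inE negb_or vX.
move=> z; rewrite inE nbhdU inE => /orP[/eqP-> | /sX ->] //.
by rewrite wY orbT.
Qed.

End TightSets.

(** Induction on [J]: [tight_extend], with demand 1 on [J] and 0 elsewhere, finds for [v] a mate
    whose removal keeps Hall's condition on the rest. [w0] is the value used when [J] is empty. *)
Lemma hall (I W : finType) (w0 : W) (J : {set I}) (N : I -> {set W}) :
  (forall X : {set I}, X \subset J -> #|X| <= #|nbhd N X|) ->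
  exists2 h : I -> W, {in J &, injective h} & {in J, forall i, h i \in N i}.
Proof.
have [k] := ubnP #|J|; elim: k => // k IHk in J N *; rewrite ltnS => sJ hallN.
have [->|[v vJ]] := set_0Vmem J.
  by exists (fun=> w0) => [i j|i]; rewrite inE.
have sum_f (X : {set I}) : \sum_(i in X) (i \in J : nat) = #|X :&: J|.
  rewrite -sum1_card [RHS]big_mkcond [LHS]big_mkcond /=.
  by apply: eq_bigr => i _; rewrite inE; case: (i \in X); case: (i \in J).
(* With [m] above [#|I|] the size bounds always hold and no set counts as large. *)
have [||||w wN wP] := @tight_extend I W N (fun i => i \in J) #|I|.+1 _ _ v.
- move=> X _; rewrite sum_f; apply: leq_trans (hallN _ (subsetIr X J)) _.
  exact/subset_leq_card/nbhdS/subsetIl.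
- by move=> X ltX; have := max_card (mem X); rewrite leqNgt ltX.
- by [].
- by rewrite vJ.
have [||h injh hN] := IHk (J :\ v) (fun i => N i :\ w).
- by move: sJ; rewrite (cardsD1 v) vJ.
- move=> X /subsetD1P[sXJ vX].
  have -> : nbhd (fun i => N i :\ w) X = nbhd N X :\ w.
    apply/setP => z; rewrite !inE; apply/nbhdP/andP.
      by case=> i iX; rewrite !inE => /andP[-> zi]; split=> //; apply/nbhdP; exists i.
    by case=> zw /nbhdP[i iX zi]; exists i; rewrite // !inE zw.
  have := wP X _; rewrite sum_f (setIidPl sXJ) (negPf vX) subn0; apply.
  by apply: leq_trans (max_card _) _; lia.
exists (fun i => if i == v then w else h i).
  move=> i j iJ jJ; case: eqVneq => [->|iv]; case: eqVneq => [->|jv] //.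
  - by move=> Ew; have := hN j; rewrite !inE -Ew eqxx jv jJ => /(_ isT).
  - by move=> Ew; have := hN i; rewrite !inE Ew eqxx iv iJ => /(_ isT).
  - by apply: injh; rewrite !inE ?iv ?jv.
move=> i iJ; case: eqVneq => [->|iv] //.
by have := hN i; rewrite !inE iv iJ => /(_ isT)/andP[].
Qed.

(** * Extendable sets *)

Section Extendable.

Variables (V : finType) (e : rel V) (D m : nat).

Definition nb (X : {set V}) : {set V} := nbhd (fun x => [set w | e x w]) X.

Lemma nbP (X : {set V}) w : reflect (exists2 x, x \in X & e x w) (w \in nb X).
Proof.
by apply: (iffP (nbhdP _ _ _)) => -[x xX]; rewrite ?inE => ew; exists x; rewrite ?inE.
Qed.

(* [B] is the set of vertices already used and [c x] counts the neighbours
   that were spent on [x]; the condition says that, with the vertices of [B]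
   gone, every small set still has [D - c x] private neighbours for each [x]. *)
Definition extendable (B : {set V}) (c : V -> nat) : Prop :=
  forall X : {set V}, #|X| <= m.*2 ->
    \sum_(x in X) (D - c x) <= #|nb X :\: B|.

Lemma eq_extendable B B' c c' :
  B = B' -> c =1 c' -> extendable B c -> extendable B' c'.
Proof.
by move=> -> eqc ext X /ext; under eq_bigr do rewrite eqc.
Qed.

(** Equivalently, any two sets of [m] vertices have an edge between them. *)
Definition joined := forall X : {set V}, m <= #|X| -> #|V| < #|nb X| + m.

Definition room (k : nat) : Prop := k + m + m.*2 * D <= #|V|.

Lemma leq_room k l : k <= l -> room l -> room k.
Proof. by rewrite /room => kl H; lia. Qed.

Lemma sum_bump (X : {set V}) (c : V -> nat) v : c v < D ->
  \sum_(x in X) (D - (c x + (x == v))) = \sum_(x in X) (D - c x) - (v \in X).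
Proof.
move=> cv; have [vX|vX] := boolP (v \in X); last first.
  rewrite subn0; apply: eq_bigr => x xX.
  by case: eqVneq xX vX => [-> ->|_ _ _] //; rewrite addn0.
rewrite !(bigD1 v vX) /= eqxx.
have -> : \sum_(i in X | i != v) (D - (c i + (i == v))) =
    \sum_(i in X | i != v) (D - c i).
  by apply: eq_bigr => i /andP[_ /negPf->]; rewrite addn0.
by set S := \sum_(i in X | _) _; move: S => S; move: cv; rewrite addn1 subn1; case: (c v) => *; lia.
Qed.

Lemma extendable_add B c v : 0 < m -> joined -> extendable B c ->
  room #|B| -> c v < D ->
  exists w, [/\ w \notin B, e v w &
    extendable (w |: B) (fun x => c x + (x == v))].
Proof.
move=> m_gt0 join ext rB cv.
have nbE X : nbhd (fun x => [set w | e x w] :\: B) X = nb X :\: B.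
  apply/setP => w; rewrite inE; apply/nbhdP/andP.
    by case=> x xX; rewrite !inE => /andP[-> ew]; split=> //; apply/nbP; exists x.
  by case=> wB /nbP[x xX ew]; exists x; rewrite // !inE wB.
have [||||w] := @tight_extend V V (fun x => [set w | e x w] :\: B)
    (fun x => D - c x) m _ _ v.
- by move=> X sX; rewrite nbE; exact: ext.
- move=> X mX sX; rewrite nbE.
  have : \sum_(x in X) (D - c x) <= #|X| * D.
    by rewrite -sum_nat_const; apply: leq_sum => x _; rewrite leq_subr.
  have := join X mX; have := cardsID B (nb X).
  have := subset_leq_card (subsetIr (nb X) B); move: rB; rewrite /room.
  by move: (#|_ :\: _|) (#|_ :&: _|) (\sum_(_ in _) _) (#|X|) sX; nia.
- by [].
- by rewrite subn_gt0.
rewrite !inE => /andP[wB ew] wP; exists w; split=> // X sX.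
rewrite sum_bump //; have := wP X sX; rewrite nbE.
suff -> : (nb X :\: B) :\ w = nb X :\: (w |: B) by [].
by apply/setP => z; rewrite !inE negb_or -andbA.
Qed.

(** [us] lists, with repetitions, the vertices that receive a neighbour; [E] records who received
    which, so that the edges can be removed again. *)
Lemma extendable_adds B c us : 0 < m -> joined -> extendable B c ->
  {in us, forall v, c v + count_mem v us <= D} -> room (#|B| + size us) ->
  exists E : seq (V * V), [/\ unzip1 E = us, uniq (unzip2 E),
    {in unzip2 E, forall w, w \notin B}, {in E, forall z, e z.1 z.2} &
    extendable (B :|: [set w in unzip2 E]) (fun v => c v + count_mem v us)].
Proof.
move=> m_gt0 join; elim: us B c => [|u us IHus] B c ext cD rB.
  exists [::]; split=> //; apply: eq_extendable ext => [|v]; last by rewrite addn0.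
  by apply/setP => w; rewrite !inE orbF.
have cuD : c u < D by have := cD u (mem_head _ _); rewrite /= eqxx; lia.
have [|w [wB euw ext']] := extendable_add m_gt0 join ext _ cuD.
  by apply: leq_room rB; lia.
have [||E [E1 uE EB eE extE]] := IHus _ _ ext'.
- move=> v vus; have := cD v; rewrite inE vus orbT => /(_ isT).
  by rewrite /= eq_sym addnA.
- by move: rB; rewrite cardsU1 wB /= addnS addSnnS.
exists ((u, w) :: E); split=> //=.
- by rewrite E1.
- by rewrite uE andbT; apply/negP => /EB; rewrite !inE eqxx.
- by move=> z; rewrite inE => /orP[/eqP->|/EB] //; rewrite !inE negb_or => /andP[].
- by move=> z; rewrite inE => /orP[/eqP->|/eE].
apply: eq_extendable extE => [|v]; last by rewrite addnA (eq_sym v).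
by apply/setP => z; rewrite !inE; case: (z == w); case: (z \in B).
Qed.

Lemma extendable_remove (B : {set V}) c u w : w \notin B -> e u w ->
  extendable (w |: B) (fun x => c x + (x == u)) -> extendable B c.
Proof.
move=> wB euw ext X sX.
have le1 : \sum_(x in X) (D - c x) <=
    \sum_(x in X) (D - (c x + (x == u))) + (u \in X).
  have [uX|uX] := boolP (u \in X).
    rewrite !(bigD1 u uX) /= eqxx.
    have : \sum_(i in X | i != u) (D - c i) <=
        \sum_(i in X | i != u) (D - (c i + (i == u))).
      by apply: leq_sum => i /andP[_ /negPf->]; rewrite addn0.
    move: (\sum_(i in X | _) _) (\sum_(i in X | _) _) => S1 S2 /=; lia.
  rewrite addn0; apply: leq_sum => x xX.
  by case: eqVneq xX uX => [-> ->|] //; rewrite addn0.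
apply: leq_trans le1 _.
have le2 := ext X sX; have [uX|uX] := boolP (u \in X); last first.
  rewrite addn0; apply: leq_trans le2 _; apply/subset_leq_card/setDS.
  exact: subsetUr.
have wX : w \in nb X :\: B by rewrite inE wB; apply/nbP; exists u.
rewrite (cardsD1 w) wX addnC leq_add2l; apply: leq_trans le2 _.
by apply/subset_leq_card/subsetP => z; rewrite !inE negb_or -andbA.
Qed.

Lemma extendable_removes (B : {set V}) c (E : seq (V * V)) : uniq (unzip2 E) ->
  {in unzip2 E, forall w, w \notin B} -> {in E, forall z, e z.1 z.2} ->
  extendable (B :|: [set w in unzip2 E]) (fun v => c v + count_mem v (unzip1 E)) ->
  extendable B c.
Proof.
elim: E B c => [|[u w] E IHE] B c /=.
  move=> _ _ _; apply: eq_extendable => [|v]; last by rewrite addn0.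
  by apply/setP => z; rewrite !inE orbF.
case/andP => wE uE EB eE ext.
have wB : w \notin B by apply: EB; rewrite inE eqxx.
apply: (@extendable_remove _ _ u w) => //.
  by apply: (eE (u, w)); rewrite inE eqxx.
apply: IHE => //.
- move=> z zE; rewrite !inE negb_or EB ?inE ?zE ?orbT // andbT.
  by apply: contraNneq wE => <-.
- by move=> z zE; apply: eE; rewrite inE zE orbT.
apply: eq_extendable ext => [|v]; last by rewrite addnA (eq_sym v).
by apply/setP => z; rewrite !inE; case: (z == w); case: (z \in B).
Qed.

Definition replicate (g : nat) (X : seq V) : seq V :=
  flatten [seq nseq g x | x <- X].

Lemma size_replicate g X : size (replicate g X) = size X * g.
Proof.
by elim: X => //= x X IH; rewrite /replicate /= size_cat size_nseq mulSn -IH.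
Qed.

Lemma count_replicate g X v : count_mem v (replicate g X) = g * count_mem v X.
Proof.
elim: X => [|x X IH] /=; first by rewrite muln0.
by rewrite /replicate /= count_cat count_nseq IH mulnDr mulnC.
Qed.

Lemma mem_replicate g X v : v \in replicate g X -> v \in X.
Proof. by case/flatten_mapP => x xX; rewrite mem_nseq => /andP[_ /eqP->]. Qed.

(* Grow [g]-ary trees of depth [k] from [X] and [Y]; the last layers are joined
   by an edge, and all branches off the resulting path are removed again. *)
Lemma connect_paths g k N (B : {set V}) c X Y : 0 < m -> joined -> 1 < g ->
  extendable B c -> size X = N -> size Y = N -> uniq (X ++ Y) ->
  {subset X ++ Y <= B} ->
  (forall v, v \in X ++ Y -> c v + g <= D) ->
  (forall v, v \notin B -> c v + g <= D) ->
  m <= N * g ^ k -> room (#|B| + 4 * N * (g ^ k - 1)) ->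
  exists x a p q, [/\ x \in X, a \in Y, size p = k, size q = k &
    [/\ path e x p, path e a q, e (last x p) (last a q), uniq (p ++ q) &
    {in p ++ q, forall v, v \notin B} /\
    extendable (B :|: [set v in p ++ q])
      (fun v => c v + count_mem v (belast x p) + count_mem v (belast a q))]].
Proof.
move=> m_gt0 join g_gt1.
elim: k N B c X Y => [|k IHk] N B c X Y ext sX sY uXY XYB cXY cB mN rB.
  rewrite muln1 in mN.
  have /andP[uX /andP[_ uY]] : uniq X && (~~ has (mem X) Y && uniq Y)
    by rewrite -cat_uniq.
  have cX : #|[set v in X]| = N by rewrite cardsE (card_uniqP uX).
  have cY : #|[set v in Y]| = N by rewrite cardsE (card_uniqP uY).
  have := @join [set v in X]; rewrite cX => /(_ mN) ltV.
  have [a] : exists a, a \in nb [set v in X] :&: [set v in Y].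
    apply/set0Pn; rewrite -card_gt0.
    have := cardsUI (nb [set v in X]) [set v in Y].
    have : #|nb [set v in X] :|: [set v in Y]| <= #|V| := max_card _; lia.
  rewrite !inE => /andP[/nbP[x]]; rewrite inE => xX exa aY.
  (* The closing edge joins two used vertices, so neither [B] nor [c] changes. *)
  exists x, a, [::], [::]; split=> //; split=> //; split=> //.
  apply: eq_extendable ext => [|v]; last by rewrite /= !addn0.
  by apply/setP => z; rewrite !inE orbF.
have gk : 0 < g ^ k by rewrite expn_gt0 (ltnW g_gt1).
pose us := replicate g X ++ replicate g Y.
have count_us v : count_mem v us = g * (v \in X ++ Y).
  by rewrite count_cat !count_replicate -mulnDr -count_cat count_uniq_mem.
have count_B v : v \notin B -> count_mem v us = 0.
  by move=> vB; rewrite count_us (contraNF (XYB v)) ?muln0.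
have [||E [E1 uE EB eE extE]] := extendable_adds (us := us) m_gt0 join ext.
- move=> v; rewrite count_us => vus.
  have vXY : v \in X ++ Y.
    by move: vus; rewrite !mem_cat => /orP[]/mem_replicate->; rewrite ?orbT.
  by rewrite vXY muln1 cXY.
- apply: leq_room rB; rewrite size_cat !size_replicate sX sY expnS; nia.
have [F1 F2] : unzip1 (take (N * g) E) = replicate g X /\
    unzip1 (drop (N * g) E) = replicate g Y.
  rewrite /unzip1 map_take map_drop -/(unzip1 E) E1 -sX -size_replicate.
  by rewrite take_size_cat ?drop_size_cat.
pose X1 := unzip2 (take (N * g) E); pose Y1 := unzip2 (drop (N * g) E).
have XY1 : X1 ++ Y1 = unzip2 E by rewrite -map_cat cat_take_drop.
have sX1 : size X1 = N * g.
  by have := congr1 size F1; rewrite !size_map size_replicate sX.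
have sY1 : size Y1 = N * g.
  by have := congr1 size F2; rewrite !size_map size_replicate sY.
have [||||||x1 [a1 [p [q]]]] := IHk (N * g) _ _ X1 Y1 extE sX1 sY1.
- by rewrite XY1.
- by move=> v; rewrite XY1 !inE => ->; rewrite orbT.
- by move=> v; rewrite XY1 => /EB vB; rewrite count_B // addn0 cB.
- by move=> v; rewrite !inE negb_or => /andP[vB _]; rewrite count_B // addn0 cB.
- by rewrite -mulnA -expnS.
(* Forests of depth [k] with [N] roots on either side take [2 N (g + ... + g ^ k)] new vertices, at
   most [4 N (g ^ k - 1)] since [g >= 2]. *)
- apply: leq_room rB; have : #|B :|: [set w in unzip2 E]| <= #|B| + (N * g + N * g).
    apply: leq_trans (leq_card_setU _ _) _; rewrite leq_add2l cardsE.
    by apply: leq_trans (card_size _) _; rewrite -XY1 size_cat sX1 sY1.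
  by rewrite expnS; nia.
case=> x1X a1Y sp sq [ep eq epq upq [pqB extpq]].
have [[x x1'] zx /= x1E] := mapP x1X; have [[a a1'] za /= a1E] := mapP a1Y.
subst x1' a1'.
have xX : x \in X.
  by apply: (@mem_replicate g); rewrite -F1; apply/mapP; exists (x, x1).
have aY : a \in Y.
  by apply: (@mem_replicate g); rewrite -F2; apply/mapP; exists (a, a1).
have zxE : (x, x1) \in E := mem_take zx.
have zaE : (a, a1) \in E := mem_drop za.
have x1B : x1 \notin B by apply: EB; rewrite -XY1 mem_cat x1X.
have a1B : a1 \notin B by apply: EB; rewrite -XY1 mem_cat a1Y orbT.
have x1a1 : x1 != a1.
  move: uE; rewrite -XY1 cat_uniq => /and3P[_ /hasPn/(_ a1 a1Y) /= a1X _].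
  by apply: contraNneq a1X => <-.
pose E' := rem (a, a1) (rem (x, x1) E).
have permE : perm_eq E [:: (x, x1), (a, a1) & E'].
  apply: perm_trans (perm_to_rem zxE) _; rewrite perm_cons perm_to_rem //.
  have := perm_mem (perm_to_rem zxE) (a, a1); rewrite zaE inE xpair_eqE.
  by rewrite [a1 == x1]eq_sym (negPf x1a1) andbF.
have perm2 : perm_eq (unzip2 E) [:: x1, a1 & unzip2 E'] := perm_map snd permE.
have uE' : uniq [:: x1, a1 & unzip2 E'] by rewrite -(perm_uniq perm2).
exists x, a, (x1 :: p), (a1 :: q); split=> //=; rewrite ?sp ?sq //.
have pqE v : v \in p ++ q -> v \notin B /\ v \notin [:: x1, a1 & unzip2 E'].
  move=> /pqB; rewrite in_setU negb_or in_set => /andP[vB vE].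
  by rewrite -(perm_mem perm2).
split=> //.
- by rewrite ep andbT (eE _ zxE).
- by rewrite eq andbT (eE _ zaE).
- rewrite -[_ && _]/(uniq (x1 :: p ++ a1 :: q)).
  have -> : uniq (x1 :: p ++ a1 :: q) = uniq [:: x1, a1 & p ++ q].
    by apply: perm_uniq; rewrite perm_cons (perm_catCA p [:: a1] q).
  rewrite /= upq inE negb_or x1a1 andbT; apply/andP; split.
    by apply/negP => /pqE[_]; rewrite !inE eqxx.
  by apply/negP => /pqE[_]; rewrite !inE eqxx orbT.
have pqnB : {in x1 :: p ++ a1 :: q, forall v, v \notin B}.
  move=> v; rewrite inE mem_cat inE => /or4P[/eqP->|vp|/eqP->|vq] //.
    by apply: (proj1 (pqE v _)); rewrite mem_cat vp.
  by apply: (proj1 (pqE v _)); rewrite mem_cat vq orbT.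
split=> //.
apply: (@extendable_removes _ _ E').
- by case/and3P: uE'.
- move=> w wE'; have wE : w \in unzip2 E.
    by rewrite (perm_mem perm2) !inE wE' !orbT.
  rewrite in_setU negb_or (EB w wE) in_set; apply/negP.
  case/and3P: uE' => x1E' a1E' _; rewrite inE negb_or in x1E'.
  rewrite inE mem_cat inE => /or4P[/eqP wx|wp|/eqP wa|wq].
  - by move: x1E'; rewrite -wx wE' andbF.
  - have [|_] := pqE w; first by rewrite mem_cat wp.
    by rewrite !inE wE' !orbT.
  - by move: a1E'; rewrite -wa wE'.
  - have [|_] := pqE w; first by rewrite mem_cat wq orbT.
    by rewrite !inE wE' !orbT.
- by move=> z zE'; apply: eE; rewrite (perm_mem permE) !inE zE' !orbT.
apply: eq_extendable extpq => [|v].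
  apply/setP => z; rewrite !inE !mem_cat (perm_mem perm2) !inE.
  case: (z \in B); case: (z == x1); case: (z == a1) => //;
    by case: (z \in p); case: (z \in q); case: (z \in unzip2 E').
have cE : count_mem v us = (x == v) + ((a == v) + count_mem v (unzip1 E')).
  by rewrite -E1; have /permP/(_ (pred1 v)) := perm_map fst permE.
rewrite cE /= -!addnA; congr (_ + _).
move: (count_mem v (unzip1 E')) (count_mem v (belast x1 p)) => i j.
move: (count_mem v (belast a1 q)) (x == v : nat) (a == v : nat) => l i' j'.
clear; lia.
Qed.

(** Private neighbours of [3 m + 1] arbitrary vertices form [A0]; by [joined], a set of at least [m]
    vertices has more than [2 m] neighbours in it. So a largest bad set [Ys] has at most [m]
    elements, and private neighbours [A1] of its own can be added. For small [Y], [A1] serves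
    [Y :&: Ys], and [A0] serves [Y :\: Ys] because [Ys :|: Y] is not bad unless it equals [Ys]. *)
Lemma dominating_set : 0 < m -> joined -> 1 < D ->
  extendable set0 (fun=> 0) -> room (4 * m).+1 ->
  exists (A : {set V}) (c : V -> nat), [/\ extendable A c,
    forall v, c v <= 2, #|A| <= (4 * m).+1 &
    forall Y : {set V}, #|Y| <= m -> #|Y| <= #|nb Y :&: A|].
Proof.
move=> m_gt0 join D_gt1 ext0 rm.
pose us := take (3 * m).+1 (enum V).
have us_uniq : uniq us by rewrite take_uniq ?enum_uniq.
have sz_us : size us = (3 * m).+1.
  by rewrite size_takel // -cardT; move: rm; rewrite /room; nia.
have [||E0 [E01 uE0 _ eE0 ext1]] := extendable_adds (us := us) m_gt0 join ext0.
- by move=> v _; rewrite count_uniq_mem //; case: (v \in us); lia.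
- by apply: leq_room rm; rewrite cards0 sz_us; lia.
set A0 : {set V} := [set w in unzip2 E0].
have cA0 : #|A0| = (3 * m).+1.
  by rewrite cardsE (card_uniqP uE0) size_map -sz_us -E01 size_map.
pose bad (Y : {set V}) := (#|Y| <= m.*2) && (#|nb Y :&: A0| <= #|Y|).
have bad0 : bad set0.
  by rewrite /bad cards0 leqn0 /= cards_eq0 /nb /nbhd big_set0 set0I.
have [Ys /andP[szYs badYs] maxYs] := arg_maxnP (fun Y : {set V} => #|Y|) bad0.
have Ys_m : #|Ys| <= m.
  rewrite leqNgt; apply/negP => /ltnW /join ltV.
  have := cardsUI (nb Ys) A0.
  by have : #|nb Ys :|: A0| <= #|V| := max_card _; lia.
have ext1' : extendable A0 (fun v => count_mem v us).
  by apply: eq_extendable ext1 => //; rewrite set0U.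
have [||E1 [E11 uE1 E1A0 eE1 ext2]] :=
    extendable_adds (us := enum Ys) m_gt0 join ext1'.
- move=> v _; rewrite !count_uniq_mem ?enum_uniq //.
  by case: (v \in us); case: (v \in enum Ys); lia.
- by apply: leq_room rm; rewrite cA0 -cardE; lia.
set A1 : {set V} := [set w in unzip2 E1] in ext2.
have dA : A0 :&: A1 = set0.
  apply/setP => w; rewrite !inE; apply/negP => /andP[wE0 /E1A0].
  by rewrite inE wE0.
exists (A0 :|: A1), (fun v => count_mem v us + count_mem v (enum Ys)).
split=> //.
- move=> v; rewrite !count_uniq_mem ?enum_uniq //.
  by case: (v \in us); case: (v \in enum Ys); lia.
- have : #|A1| <= m.
    apply: leq_trans Ys_m; rewrite cardsE (card_uniqP uE1) size_map.
    by rewrite -(size_map fst) -/(unzip1 E1) E11 -cardE.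
  by have := cardsUI A0 A1; lia.
move=> Y szY.
have le1 : #|Y :&: Ys| <= #|nb Y :&: A1|.
  pose F := [seq z <- E1 | z.1 \in Y].
  have uF : uniq (unzip2 F).
    by apply: subseq_uniq uE1; apply/map_subseq/filter_subseq.
  have <- : #|[set w in unzip2 F]| = #|Y :&: Ys|.
    rewrite cardsE (card_uniqP uF) size_map size_filter.
    rewrite -(count_map fst (mem Y)) -/(unzip1 E1) E11 -size_filter.
    rewrite -(card_uniqP (filter_uniq _ (enum_uniq _))) -cardsE.
    by apply: eq_card => v; rewrite !inE mem_filter mem_enum.
  apply/subset_leq_card/subsetP => w; rewrite inE => /mapP[z].
  rewrite mem_filter => /andP[zY zE1] ->; rewrite !inE.
  apply/andP; split; first by apply/nbP; exists z.1 => //; exact: eE1.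
  by apply/mapP; exists z.
have le2 : #|Y :\: Ys| <= #|nb Y :&: A0|.
  have [->|neY] := eqVneq (Y :\: Ys) set0; first by rewrite cards0.
  have cU : #|Ys :|: Y| = #|Ys| + #|Y :\: Ys|.
    by have := cardsUI Ys Y; have := cardsID Ys Y; rewrite setIC; lia.
  have szD := subset_leq_card (subsetDl Y Ys).
  have : ~~ bad (Ys :|: Y).
    apply/negP => /maxYs; rewrite cU; rewrite -card_gt0 in neY; lia.
  rewrite /bad cU negb_and -!ltnNge => /orP[|]; first by lia.
  have -> : nb (Ys :|: Y) = nb Ys :|: nb Y by exact: nbhdU.
  by rewrite setIUl; have := cardsUI (nb Ys :&: A0) (nb Y :&: A0); lia.
have -> : #|Y| = #|Y :&: Ys| + #|Y :\: Ys| by rewrite cardsID.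
rewrite setIUr addnC; apply: leq_trans (leq_add le2 le1) _.
by rewrite -cardsUI setIACA dA setI0 cards0 addn0.
Qed.

End Extendable.

(** * Spanning trees with many pendant paths *)

Section Embedding.

Variables (V : finType) (e : rel V) (D m g bz S : nat).
Hypothesis e_sym : symmetric e.
Hypothesis m_gt0 : 0 < m.
Hypothesis join : joined e m.
Hypothesis g_gt1 : 1 < g.
Hypothesis D_large : g + bz + 5 <= D.
Hypothesis S_gt0 : 0 < S.

Variables (U : finType) (rt : U) (par : U -> U) (rk : U -> nat).
Hypothesis par_rk : forall u, u != rt -> rk (par u) < rk u.
Hypothesis few_children :
  forall u, #|[set v | (v != rt) && (par v == u)]| <= bz.

(* A place [x] of scale [sc x] is a pendant path [y x 0, y x 1, ...,
   y x (2 * sc x + 1)] whose last vertex has a leaf child [lf x]; only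
   its top vertex [y x 0] belongs to [Z0]. *)
Variables (Pl Z0 : {set U}) (sc : U -> nat) (y : U -> nat -> U) (lf : U -> U).
Let len x := (sc x).*2.+1.
Hypothesis Z0_rt : rt \in Z0.
Hypothesis Z0_par : {in Z0, forall u, u != rt -> par u \in Z0}.
Hypothesis y_top : {in Pl, forall x, y x 0 \in Z0}.
Hypothesis y_Z0 : {in Pl, forall x j, j < len x -> y x j.+1 \notin Z0}.
Hypothesis lf_Z0 : {in Pl, forall x, lf x \notin Z0}.
Hypothesis y_par : {in Pl, forall x j, j < len x -> par (y x j.+1) = y x j}.
Hypothesis lf_par : {in Pl, forall x, par (lf x) = y x (len x)}.
Hypothesis y_inj : {in Pl &, forall x x' j j', j < len x -> j' < len x' ->
  y x j.+1 = y x' j'.+1 -> x = x' /\ j = j'}.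
Hypothesis top_inj : {in Pl &, injective (y^~ 0)}.
Hypothesis lf_inj : {in Pl &, injective lf}.
Hypothesis lf_y : {in Pl &, forall x x' j, j < len x' -> lf x != y x' j.+1}.
Hypothesis lf_leaf : {in Pl, forall x u, u != rt -> par u != lf x}.
Hypothesis cardUV : #|U| = #|V|.

(** Embedding of a subtree containing the root. The tree is given by [par]; [rk], which drops from a
    vertex to its parent, excludes cycles. *)
Definition emb (Dm : {set U}) (f : U -> V) : Prop :=
  [/\ rt \in Dm, {in Dm, forall u, u != rt -> par u \in Dm},
      {in Dm &, injective f} &
      {in Dm, forall u, u != rt -> e (f (par u)) (f u)}].

Definition kids (Dm : {set U}) u := #|[set v in Dm | (v != rt) && (par v == u)]|.

(** [Ar] is the part of [A] not yet reached. A vertex outside the image has spent at most 3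
    neighbours: two on building [A], one on starting the embedding. An embedded vertex spends one
    per embedded child, and possibly a fourth extra one, on its parent, if it lies on the half of a
    link that was grown from [A]. *)
Definition state (Dm : {set U}) (f : U -> V) (Ar : {set V}) (c : V -> nat) :=
  [/\ emb Dm f, [disjoint f @: Dm & Ar], extendable e D m (f @: Dm :|: Ar) c,
      {in Dm, forall u, c (f u) <= 4 + kids Dm u} &
      forall v, v \notin f @: Dm -> c v <= 3].

Definition upd (f : U -> V) u w := fun v => if v == u then w else f v.

Lemma emb_add Dm f u w : emb Dm f -> u \notin Dm -> u != rt ->
  par u \in Dm -> w \notin f @: Dm -> e (f (par u)) w ->
  [/\ emb (u |: Dm) (upd f u w), {in Dm, upd f u w =1 f} &
      upd f u w @: (u |: Dm) = w |: f @: Dm].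
Proof.
move=> [rD pD injf ef] uD urt puD wD ew.
have updD : {in Dm, upd f u w =1 f}.
  by move=> v vD; rewrite /upd; case: eqVneq vD uD => // -> ->.
have updu : upd f u w u = w by rewrite /upd eqxx.
split=> //; last first.
  by rewrite imsetU1 updu; congr (_ |: _); apply: eq_in_imset.
split.
- by rewrite inE rD orbT.
- move=> v; rewrite !inE => /orP[/eqP->|vD] vrt; first by rewrite puD orbT.
  by rewrite pD ?orbT.
- move=> v v'; rewrite !inE => /orP[/eqP->|vD] /orP[/eqP->|v'D] //.
  + by rewrite updu updD // => wE; rewrite wE imset_f in wD.
  + by rewrite updu updD // => wE; rewrite -wE imset_f in wD.
  + by rewrite !updD //; exact: injf.
- move=> v; rewrite !inE => /orP[/eqP->|vD] vrt; first by rewrite updu updD.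
  by rewrite !updD ?pD // ef.
Qed.

Lemma leq_kids (Dm Dm' : {set U}) u : Dm \subset Dm' -> kids Dm u <= kids Dm' u.
Proof.
move=> /subsetP sD; apply/subset_leq_card/subsetP => v.
by rewrite !inE => /andP[/sD->].
Qed.

Lemma kids_bz Dm u : kids Dm u <= bz.
Proof.
apply: leq_trans (few_children u); apply/subset_leq_card/subsetP => v.
by rewrite !inE => /andP[].
Qed.

Lemma kids_add (Dm Dm' : {set U}) v u : Dm \subset Dm' -> v \notin Dm ->
  v \in Dm' -> v != rt -> par v = u -> kids Dm u < kids Dm' u.
Proof.
move=> /subsetP sD vD vD' vrt pv; apply/proper_card/properP; split.
  by apply/subsetP => z; rewrite !inE => /andP[/sD->].
by exists v; rewrite !inE ?vD' ?vrt ?pv ?eqxx //= (negPf vD).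
Qed.

Lemma card_state Dm f Ar c : state Dm f Ar c ->
  #|f @: Dm :|: Ar| = #|Dm| + #|Ar|.
Proof.
case=> -[_ _ injf _] dis _ _ _; have := cardsUI (f @: Dm) Ar.
by rewrite (disjoint_setI0 dis) cards0 addn0 (card_in_imset injf).
Qed.

Lemma state_add Dm f Ar c u : state Dm f Ar c -> u \notin Dm -> u != rt ->
  par u \in Dm -> room V D m (#|Dm| + #|Ar|) ->
  exists w c', state (u |: Dm) (upd f u w) Ar c' /\ {in Dm, upd f u w =1 f}.
Proof.
move=> st uD urt puD rm; have cst := card_state st.
case: (st) => em dis ext cD cO.
have cpu : c (f (par u)) < D.
  by have := cD _ puD; have := kids_bz Dm (par u); lia.
rewrite -cst in rm.
have [w [wB ew ext']] := extendable_add m_gt0 join ext rm cpu.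
move: wB; rewrite inE negb_or => /andP[wD wA].
have [em' fE imE] := emb_add em uD urt puD wD ew.
exists w, (fun x => c x + (x == f (par u))); split=> //; split=> //.
- by rewrite imE disjoints_subset subUset sub1set inE wA -disjoints_subset.
- by rewrite imE -setUA; exact: ext'.
- move=> v; rewrite !inE => /orP[/eqP->|vD].
    rewrite /upd eqxx; have := cO w wD.
    case: eqVneq => [wE|_]; last by lia.
    by rewrite wE imset_f in wD.
  rewrite fE //; have := cD _ vD; case: em => _ _ injf _.
  have sD : Dm \subset u |: Dm by rewrite subsetUr.
  rewrite (inj_in_eq injf) //; case: eqVneq => [vE|_].
    have : kids Dm v < kids (u |: Dm) v.
      by apply: (@kids_add _ _ u); rewrite ?setU11.
    by clear; lia.
  by have := leq_kids v sD; clear; lia.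
- move=> v; rewrite imE !inE negb_or => /andP[vw vD].
  have -> : (v == f (par u)) = false.
    by apply: contraNF vD => /eqP->; rewrite imset_f.
  by rewrite addn0 cO.
Qed.

(** A missing vertex of least rank has its parent in [Dm], so [Tg] can be filled by increasing
    rank. *)
Lemma state_fill Dm f Ar c (Tg : {set U}) : state Dm f Ar c ->
  Dm \subset Tg -> {in Tg, forall u, u != rt -> par u \in Tg} ->
  room V D m (#|Tg| + #|Ar|) ->
  exists f' c', state Tg f' Ar c' /\ {in Dm, f' =1 f}.
Proof.
have [k] := ubnP #|Tg :\: Dm|; elim: k => // k IHk in Dm f c *.
rewrite ltnS => szk st sub clo rm.
have [TD|[u0 u0T]] := set_0Vmem (Tg :\: Dm).
  have -> : Tg = Dm by apply/eqP; rewrite eqEsubset sub -setD_eq0 TD eqxx.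
  by exists f, c.
have [u uT umin] := arg_minnP rk u0T.
have /setDP[uTg uD] : u \in Tg :\: Dm by exact: uT.
have [em _ _ _ _] := st; have [rD _ _ _] := em.
have urt : u != rt by apply: contraNneq uD => ->.
have puD : par u \in Dm.
  apply: contraLR (par_rk urt) => puD; rewrite -leqNgt; apply: umin.
  by apply/setDP; rewrite puD clo.
have [|w [c1 [st1 fE1]]] := state_add st uD urt puD.
  by apply: leq_room rm; rewrite leq_add2r subset_leq_card.
have [||||f' [c' [st' fE']]] := IHk _ _ _ _ st1; rewrite ?subUset ?sub1set ?uTg //.
  by move: szk; rewrite (cardsD1 u) inE uD uTg /= setDDl [Dm :|: _]setUC.
exists f', c'; split=> // v vD; rewrite fE' ?fE1 // inE vD orbT //.
Qed.

Lemma emb_path zs ys Dm f top : emb Dm f -> top \in Dm ->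
  path (fun u v => par v == u) top zs -> rt \notin zs -> uniq zs ->
  {in zs, forall u, u \notin Dm} -> size ys = size zs ->
  path e (f top) ys -> uniq ys -> {in ys, forall w, w \notin f @: Dm} ->
  exists f', [/\ emb (Dm :|: [set u in zs]) f', {in Dm, f' =1 f},
    f' @: (Dm :|: [set u in zs]) = f @: Dm :|: [set w in ys] &
    f' (last top zs) = last (f top) ys].
Proof.
elim: zs ys Dm f top => [|u zs IHzs] [|w ys] //= Dm f top em topD.
  move=> _ _ _ _ _ _ _ _; exists f.
  have s0 (T : finType) (B : {set T}) : B :|: [set z in [::]] = B.
    by apply/setP => z; rewrite !inE orbF.
  by rewrite !s0; split.
move=> /andP[/eqP pu pzs]; rewrite inE negb_or => /andP[rtu rtzs].
move=> /andP[uzs uqzs] zsD [szs] /andP[ew pys] /andP[wys uqys] ysD.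
have uD : u \notin Dm by apply: zsD; rewrite inE eqxx.
have wD : w \notin f @: Dm by apply: ysD; rewrite inE eqxx.
have [||||||em1 fE1 imE1] := @emb_add Dm f u w; rewrite ?pu // 1?eq_sym //.
have updu : upd f u w u = w by rewrite /upd eqxx.
have [|||||||||f' [em' fE' imE' lastE]] := IHzs ys (u |: Dm) (upd f u w) u em1;
  rewrite ?setU11 ?updu //.
- move=> v vzs; rewrite !inE negb_or zsD ?inE ?vzs ?orbT // andbT.
  by apply: contraNneq uzs => <-.
- move=> v vys; rewrite imE1 !inE negb_or ysD ?inE ?vys ?orbT // andbT.
  by apply: contraNneq wys => <-.
have s1 (T : finType) (B : {set T}) z s :
    (z |: B) :|: [set v in s] = B :|: [set v in z :: s].
  by apply/setP => v; rewrite !inE; case: (v == z); case: (v \in B).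
rewrite imE1 !s1 in em' imE'; exists f'; split=> //.
- by move=> v vD; rewrite fE' ?fE1 // inE vD orbT.
- by rewrite lastE updu.
Qed.

Lemma count_belast (T : eqType) (v x : T) p :
  count_mem v (belast x p) <= count_mem v (x :: p).
Proof. by rewrite lastI -cats1 count_cat leq_addr. Qed.

Hypothesis gS_large : m <= g ^ S.

(** With [g ^ (S - s)] roots on either side, trees of depth [s] have last layers of [g ^ S >= m]
    vertices, so some top gets linked to some vertex of [as_]. The link has [2 s + 1] vertices below
    the top, the last one in [A]: exactly a pendant path of scale [s]. As [x] and [a] cannot be
    prescribed, all of [xs] must have the same scale. *)
Lemma state_connect Dm f Ar c s (xs : seq U) (as_ : seq V) :
  state Dm f Ar c -> 0 < s <= S -> {subset xs <= Pl} ->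
  {in xs, forall x, [/\ sc x = s, y x 0 \in Dm &
      forall j, j < len x -> y x j.+1 \notin Dm]} ->
  uniq xs -> uniq as_ -> {subset as_ <= Ar} ->
  size xs = g ^ (S - s) -> size as_ = g ^ (S - s) ->
  room V D m (#|Dm| + #|Ar| + 4 * g ^ S) ->
  exists x a f' c', [/\ x \in xs, a \in Ar,
    state (Dm :|: [set u in mkseq (fun j => y x j.+1) (len x)]) f' (Ar :\ a) c',
    {in Dm, f' =1 f} & f' (y x (len x)) = a].
Proof.
move=> st srange xsP xsD uxs uas asA szxs szas rm; have cst := card_state st.
case: (st) => em dis ext cD cO; case: (em) => rD pD injf ef.
pose X := [seq f (y x 0) | x <- xs].
have XD v : v \in X -> v \in f @: Dm.
  by case/mapP => x xxs ->; have [_ yD _] := xsD x xxs; rewrite imset_f.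
have uX : uniq X.
  rewrite map_inj_in_uniq // => x x' xxs x'xs.
  have [_ yD _] := xsD x xxs; have [_ yD' _] := xsD x' x'xs.
  by move/(injf _ _ yD yD')/top_inj; apply; exact: xsP.
have AD v : v \in Ar -> v \notin f @: Dm.
  by move=> vA; rewrite (disjointFl dis vA).
have [||||||||x0 [a [p [q]]]] := @connect_paths V e D m g s (g ^ (S - s))
    (f @: Dm :|: Ar) c X as_ m_gt0 join g_gt1 ext.
- by rewrite size_map.
- by [].
- rewrite cat_uniq uX uas andbT; apply/hasPn => v /asA/AD; exact: contra (XD v).
- move=> v; rewrite mem_cat inE => /orP[/XD->//|/asA->]; exact: orbT.
- move=> v; rewrite mem_cat => /orP[/mapP[x xxs ->]|/asA/AD/cO].
    have [_ yD _] := xsD x xxs; have := cD _ yD; have := kids_bz Dm (y x 0); lia.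
  lia.
- move=> v; rewrite inE negb_or => /andP[/cO + _]; lia.
- by rewrite -expnD subnK //; case/andP: srange.
- apply: leq_room rm; rewrite cst leq_add2l -!mulnA leq_mul2l /= mulnBr -expnD.
  by rewrite subnK ?leq_subr //; case/andP: srange.
case=> /mapP[x xxs x0E] aas sp sq [ep eq epq upq [pqB extpq]].
have [scx yD yDn] := xsD x xxs; have xP := xsP x xxs.
have aA := asA a aas; have aD := AD a aA.
have pqD v : v \in p ++ q -> v \notin f @: Dm /\ v \notin Ar.
  by move/pqB; rewrite inE negb_or => /andP[].
pose zs := mkseq (fun j => y x j.+1) (len x).
pose ys := p ++ rev (a :: q).
have memys v : (v \in ys) = (v == a) || (v \in p ++ q).
  by rewrite !mem_cat mem_rev inE orbCA.
have y_rt j : j < len x -> y x j.+1 != rt.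
  by move=> jl; apply: contraNneq (yDn j jl) => ->.
have zsP u : u \in zs -> exists2 j, j < len x & u = y x j.+1.
  by case/mapP => j; rewrite mem_iota add0n => jl ->; exists j.
have [||||||||f' [em' fE' imE' lastE]] := @emb_path zs ys Dm f (y x 0) em yD.
- have lastz n : last (y x 0) (mkseq (fun j => y x j.+1) n) = y x n.
    by case: n => // n; rewrite (last_nth (y x 0)) size_mkseq [LHS]nth_mkseq.
  have pp n : n <= len x ->
      path (fun u v => par v == u) (y x 0) (mkseq (fun j => y x j.+1) n).
    elim: n => // n IHn nl; rewrite /mkseq -addn1 iotaD map_cat cat_path /=.
    have := lastz n; rewrite /mkseq => ->; rewrite add0n.
    by rewrite [path _ _ _]IHn ?(ltnW nl) // andbT y_par ?eqxx.
  exact: pp.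
- by apply/negP => /zsP[j jl rE]; have := y_rt j jl; rewrite -rE eqxx.
- by apply/mkseq_uniqP => i j; rewrite !inE => il jl /(y_inj xP xP il jl)[].
- by move=> u /zsP[j jl ->]; exact: yDn.
- by rewrite /zs size_mkseq size_cat size_rev /= sp sq /len scx -addnn addnS.
- rewrite -x0E cat_path ep /= lastI rev_rcons /= epq /= rev_path.
  by rewrite (eq_path (e' := e)) // => u v; rewrite e_sym.
- have -> : uniq ys = uniq (p ++ (a :: q)).
    by apply: perm_uniq; rewrite perm_cat2l perm_rev.
  rewrite -cat1s uniq_catCA /= upq andbT.
  by apply/negP => /pqD[_]; rewrite aA.
- by move=> v; rewrite memys => /orP[/eqP->//|/pqD[]].
pose c' v := c v + count_mem v (belast x0 p) + count_mem v (belast a q).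
have c'_ub v : c' v <= c v + count_mem v ((x0 :: p) ++ (a :: q)).
  rewrite /c' -addnA leq_add2l count_cat.
  by apply: leq_add; exact: count_belast.
have c'_out v : v \notin (x0 :: p) ++ (a :: q) -> c' v <= c v.
  by move=> /count_memPn cv; have := c'_ub v; rewrite cv addn0.
have upq' : uniq ((x0 :: p) ++ (a :: q)).
  have x0D : x0 \in f @: Dm by rewrite x0E imset_f.
  have -> : uniq ((x0 :: p) ++ a :: q) = uniq [:: x0, a & p ++ q].
    by apply: perm_uniq; rewrite perm_cons (perm_catCA p [:: a] q).
  rewrite /= upq inE negb_or andbT -andbA; apply/and3P; split.
  - by apply: contraNneq aD => <-.
  - by apply/negP => /pqD[]; rewrite x0D.
  - by apply/negP => /pqD[_]; rewrite aA.
have c'_1 v : c' v <= (c v).+1.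
  by apply: leq_trans (c'_ub v) _; rewrite count_uniq_mem // -addn1 leq_add2l leq_b1.
have memE v : (v \in (x0 :: p) ++ a :: q) = (v == x0) || (v \in ys).
  by rewrite memys !(mem_cat, inE) -!orbA; congr (_ || _); rewrite orbCA.
exists x, a, f', c'; split=> //; last first.
  have -> : y x (len x) = last (y x 0) zs.
    by rewrite /zs (last_nth (y x 0)) size_mkseq [RHS]nth_mkseq.
  by rewrite lastE last_cat /= rev_cons last_rcons.
split=> //.
- rewrite imE' disjoints_subset; apply/subsetP => v; rewrite !inE negb_and negbK.
  case/orP => [vD|]; first by rewrite (disjointFr dis vD) orbT.
  by rewrite memys => /orP[->//|/pqD[_ ->]]; rewrite orbT.
- apply: eq_extendable extpq => //; apply/setP => v.
  rewrite imE' !inE memys; case: (v \in f @: Dm) => //=.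
  by case: eqVneq => [->|_] /=; [rewrite aA | rewrite orbC].
- move=> u; rewrite -/zs in_setU in_set => /orP[uD|].
    have sD : Dm \subset Dm :|: [set u in zs] by rewrite subsetUl.
    rewrite fE' //; have := cD u uD.
    have [uE|ufx] := eqVneq u (y x 0).
      have : kids Dm u < kids (Dm :|: [set u in zs]) u.
        apply: (@kids_add _ _ (y x 1)); rewrite ?yDn ?y_rt ?y_par //.
        rewrite in_setU in_set; apply/orP; right.
        by apply/mapP; exists 0; rewrite ?mem_iota.
      by have := c'_1 (f u); move: (c' _); clear; lia.
    have : c' (f u) <= c (f u).
      apply: c'_out; rewrite memE negb_or x0E (inj_in_eq injf) // ufx /= memys.
      rewrite negb_or; apply/andP; split.
        by apply: contraNneq aD => <-; rewrite imset_f.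
      by apply/negP => /pqD[]; rewrite imset_f.
    by have := leq_kids u sD; move: (c' _); clear; lia.
  move=> uzs; have f'u : f' u \in ys.
    have : f' u \in f @: Dm :|: [set w in ys].
      by rewrite -imE' imset_f // in_setU in_set uzs orbT.
    rewrite !inE => /orP[/imsetP[u' u'D]|//].
    rewrite -fE' // => /(let: And4 _ _ injf' _ := em' in injf' u u').
    rewrite !in_setU in_set uzs u'D orbT => /(_ isT isT) uu'.
    by have [j jl uE] := zsP u uzs; have := yDn j jl; rewrite -uE uu' u'D.
  (* On the half grown from [a] the neighbour spent is the parent in the tree, not a child; the step
     from 3 to 4 pays for it. *)
  have : c (f' u) <= 3.
    by apply: cO; move: f'u; rewrite memys => /orP[/eqP->|/pqD[]].
  by have := c'_1 (f' u); move: (c' _); clear; lia.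
- move=> v; rewrite imE' !inE negb_or => /andP[vD vys].
  apply: leq_trans (c'_out v _) (cO v vD).
  rewrite memE negb_or vys andbT; apply: contraNneq vD => ->.
  by rewrite x0E imset_f.
Qed.

Hypothesis many_places : forall s, 0 < s <= S ->
  6 * g ^ (S.+1 - s) <= #|[set x in Pl | sc x == s]|.
Hypothesis Pl_large : 6 * m + 4 * g ^ S + m.*2 * D < #|Pl|.

Variable A : {set V}.
Hypothesis A_small : #|A| <= (4 * m).+1.

(** [Us] holds the places already linked, whose ends cover [A :\: Ar]. All leaves [lf x] wait for
    the final matching. *)
Definition progress (Us Dm : {set U}) (f : U -> V) (Ar : {set V})
    (c : V -> nat) : Prop :=
  [/\ state Dm f Ar c, Us \subset Pl, Z0 \subset Dm,
      {in Pl :\: Us, forall x j, j < len x -> y x j.+1 \notin Dm} &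
      [/\ {in Pl, forall x, lf x \notin Dm}, Ar \subset A &
      {in A :\: Ar, forall a,
         exists2 x, x \in Us & y x (len x) \in Dm /\ f (y x (len x)) = a}]].

(** No [lf x] is embedded yet, so at least [#|Pl|] vertices of [V] lie outside the image, and
    [Pl_large] makes this enough. *)
Lemma room_progress Us Dm f Ar c : progress Us Dm f Ar c ->
  room V D m (#|Dm| + #|Ar| + 4 * g ^ S).
Proof.
case=> _ _ _ _ [lfD /subset_leq_card sA _].
have dD : Dm :&: lf @: Pl = set0.
  apply/setP => u; rewrite !inE; apply/negP => /andP[uD /imsetP[x xP uE]].
  by have := lfD x xP; rewrite -uE uD.
have := cardsUI Dm (lf @: Pl); rewrite dD cards0 addn0 (card_in_imset lf_inj).
have : #|Dm :|: lf @: Pl| <= #|U| := max_card _.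
move: A_small Pl_large m_gt0 sA; rewrite /room -cardUV.
by move: (g ^ S) (m.*2 * D); clear; lia.
Qed.

Lemma progress_step s Us Dm f Ar c : 0 < s <= S -> progress Us Dm f Ar c ->
  g ^ (S - s) <= #|Ar| -> g ^ (S - s) <= #|[set x in Pl :\: Us | sc x == s]| ->
  exists x a Dm' f' c', [/\ x \in Pl :\: Us, sc x = s, a \in Ar &
    progress (x |: Us) Dm' f' (Ar :\ a) c'].
Proof.
move=> srange pr leA leP; have rm := room_progress pr.
case: pr => st sUP sZD yUs [lfD sAr cov].
pose F := [set x in Pl :\: Us | sc x == s].
pose xs := take (g ^ (S - s)) (enum F).
pose as_ := take (g ^ (S - s)) (enum Ar).
have xsF x : x \in xs -> x \in F by move/mem_take; rewrite mem_enum.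
have FP x : x \in F -> [/\ x \in Pl, x \notin Us & sc x = s].
  by rewrite !inE => /andP[/andP[-> ->] /eqP].
have [||||||||x [a [f' [c' [xxs aA st' fE f'y]]]]] :=
    @state_connect Dm f Ar c s xs as_ st srange.
- by move=> x /xsF/FP[].
- move=> x /xsF/FP[xP xUs scx]; split=> //.
    exact/(subsetP sZD)/y_top.
  by move=> j jl; apply: yUs; rewrite // inE xUs.
- by rewrite take_uniq ?enum_uniq.
- by rewrite take_uniq ?enum_uniq.
- by move=> a /mem_take; rewrite mem_enum.
- by rewrite size_takel // -cardE.
- by rewrite size_takel // -cardE.
- by [].
have [xP xUs scx] := FP x (xsF x xxs).
pose zs := mkseq (fun j => y x j.+1) (len x).
have zsP u : u \in zs -> exists2 j, j < len x & u = y x j.+1.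
  by case/mapP => j; rewrite mem_iota add0n => jl ->; exists j.
exists x, a, (Dm :|: [set u in zs]), f', c'.
split=> //; first by rewrite inE xUs.
split=> //.
- by rewrite subUset sub1set xP.
- exact: subset_trans sZD (subsetUl _ _).
- move=> x' /setDP[x'P]; rewrite in_setU1 negb_or => /andP[x'x x'Us] j jl.
  rewrite in_setU negb_or in_set yUs ?inE ?x'Us //=; apply/negP => /zsP[j' jl' /(y_inj x'P xP jl jl')].
  by case=> xx'; rewrite xx' eqxx in x'x.
split.
- move=> x' x'P; rewrite in_setU in_set negb_or lfD //=; apply/negP => /zsP[j jl].
  by apply/eqP/lf_y.
- exact: subset_trans (subD1set _ _) sAr.
move=> a'; rewrite !inE negb_and negbK => /andP[/orP[/eqP->|a'Ar] a'A].
  exists x; first by rewrite !inE eqxx.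
  split=> //; rewrite in_setU in_set; apply/orP; right.
  by apply/mapP; exists (sc x).*2; rewrite // mem_iota /= ltnS.
have [|x' x'Us [yD' fy']] := cov a'; first by rewrite inE a'Ar.
by exists x'; rewrite ?in_setU1 ?x'Us ?orbT // in_setU yD' fE.
Qed.

(** A link trades one unreached vertex for one used place of scale [s], so the sum bounded by
    [5 * g ^ (S.+1 - s)] is constant. Of the [6 * g ^ (S.+1 - s)] places of this scale enough stay
    free throughout. *)
Lemma progress_stage s Us Dm f Ar c : 0 < s <= S -> progress Us Dm f Ar c ->
  {in Us, forall x, sc x <= s} ->
  #|[set x in Us | sc x == s]| + #|Ar| <= 5 * g ^ (S.+1 - s) ->
  exists Us' Dm' f' Ar' c', [/\ progress Us' Dm' f' Ar' c',
    {in Us', forall x, sc x <= s} & #|Ar'| < g ^ (S - s)].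
Proof.
move=> srange; have [k] := ubnP #|Ar|.
elim: k => // k IHk in Us Dm f Ar c *; rewrite ltnS => szk pr scUs le5.
have [ltA|leA] := ltnP #|Ar| (g ^ (S - s)).
  by exists Us, Dm, f, Ar, c.
have [_ sUP _ _ _] := pr.
have [|x [a [Dm' [f' [c' [xP scx aA pr']]]]]] := progress_step srange pr leA.
  have := many_places srange.
  have -> : [set x in Pl | sc x == s] =
      [set x in Pl :\: Us | sc x == s] :|: [set x in Us | sc x == s].
    apply/setP => x; rewrite !inE; case: (boolP (x \in Us)) => //= xUs.
      by rewrite (subsetP sUP).
    by rewrite orbF.
  move=> le6; have := leq_trans le6 (leq_card_setU _ _).
  have : g ^ (S - s) <= g ^ (S.+1 - s).
    by rewrite leq_exp2l // leq_sub2r.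
  move: le5; move: (g ^ (S - s)) (g ^ _) #|Ar| => i j l.
  by clear; lia.
have [xUs xPl] : x \notin Us /\ x \in Pl by apply/andP; rewrite inE in xP.
have [|||Us' Us'P] := IHk _ _ _ _ _ _ pr'.
- by move: szk; rewrite (cardsD1 a) aA.
- by move=> x'; rewrite !inE => /orP[/eqP->|/scUs//]; rewrite scx.
- have -> : [set x' in x |: Us | sc x' == s] = x |: [set x' in Us | sc x' == s].
    apply/setP => x'; rewrite !inE; case: eqVneq => [->|_] //=.
    by rewrite scx eqxx.
  move: le5; rewrite cardsU1 inE (negPf xUs) /= [#|Ar|](cardsD1 a) aA.
  by rewrite addnCA add1n addSn.
by exists Us'.
Qed.

(** Stage [s] ends with fewer than [g ^ (S - s)] unreached vertices, so stage [S] ends with none.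
    The factor 5 comes from the start: [#|A| <= 4 m + 1 <= 5 * g ^ S]. *)
Lemma progress_all Us Dm f c : progress Us Dm f A c -> Us = set0 ->
  exists Us' Dm' f' c', progress Us' Dm' f' set0 c'.
Proof.
move=> pr Us0.
suff H s : s <= S -> exists Us' Dm' f' Ar' c', [/\ progress Us' Dm' f' Ar' c',
    {in Us', forall x, sc x <= s} & #|Ar'| <= 5 * g ^ (S - s)
    /\ (0 < s -> #|Ar'| < g ^ (S - s))].
  have [Us' [Dm' [f' [Ar' [c' [pr' _ [_ /(_ S_gt0)]]]]]]] := H S (leqnn S).
  rewrite subnn expn0 ltnS leqn0 cards_eq0 => /eqP Ar0.
  by exists Us', Dm', f', c'; rewrite -Ar0.
elim: s => [_|s IHs sS].
  exists Us, Dm, f, A, c; split=> //; first by move=> x; rewrite Us0 inE.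
  split=> //; rewrite subn0; apply: leq_trans A_small _.
  by move: gS_large m_gt0; move: (g ^ S); clear; lia.
have [Us' [Dm' [f' [Ar' [c' [pr' scUs' [leA _]]]]]]] := IHs (ltnW sS).
have [|||Us2 [Dm2 [f2 [Ar2 [c2 [pr2 sc2 lt2]]]]]] :=
    @progress_stage s.+1 _ _ _ _ _ _ pr'.
- by rewrite sS.
- by move=> x /scUs'/leqW.
- suff -> : [set x in Us' | sc x == s.+1] = set0 by rewrite cards0 subSS.
  apply/setP => x; rewrite !inE; apply/negP => /andP[/scUs' + /eqP scx].
  by rewrite scx ltnn.
exists Us2, Dm2, f2, Ar2, c2; split=> //; split=> //.
apply: leq_trans (ltnW lt2) _; exact: leq_pmull.
Qed.

Variable cA : V -> nat.
Hypothesis A_ext : extendable e D m A cA.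
Hypothesis cA_small : forall v, cA v <= 2.
Hypothesis A_dom : forall Y : {set V}, #|Y| <= m -> #|Y| <= #|nb e Y :&: A|.

Lemma initial_progress : exists f c, progress set0 Z0 f A c.
Proof.
have rm : room V D m (#|Z0| + #|A|).
  have dZ : Z0 :&: lf @: Pl = set0.
    apply/setP => u; rewrite !inE; apply/negP => /andP[uD /imsetP[x xP uE]].
    by have := lf_Z0 xP; rewrite -uE uD.
  have := cardsUI Z0 (lf @: Pl); rewrite dZ cards0 addn0 (card_in_imset lf_inj).
  have : #|Z0 :|: lf @: Pl| <= #|U| := max_card _.
  move: A_small Pl_large m_gt0; rewrite /room -cardUV.
  by move: (g ^ S) (m.*2 * D); clear; lia.
have /card_gt0P[v0 _] : 0 < #|V| by rewrite -cardUV; apply/card_gt0P; exists rt.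
have [||w [wA _ ext1]] := @extendable_add V e D m A cA v0 m_gt0 join A_ext.
- by apply: leq_room rm; exact: leq_addl.
- by have := cA_small v0; have := D_large; clear; lia.
have st : state [set rt] (fun=> w) A (fun x => cA x + (x == v0)).
  have imE : (fun=> w) @: [set rt] = [set w] by rewrite imset_set1.
  have c3 v : cA v + (v == v0) <= 3.
    by have := cA_small v; case: (v == v0); clear; lia.
  split.
  - split; rewrite ?set11 //.
    + by move=> u; rewrite inE => /eqP-> /eqP.
    + by move=> u v; rewrite !inE => /eqP-> /eqP->.
    + by move=> u; rewrite inE => /eqP-> /eqP.
  - by rewrite imE disjoints1.
  - by rewrite imE.
  - by move=> u _; apply: leq_trans (c3 _) _; apply: ltnW; exact: leq_addr.
  - by move=> v _.
have [|f [c [stZ _]]] := state_fill st _ Z0_par rm; first by rewrite sub1set.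
exists f, c; split=> //.
- exact: sub0set.
- by move=> x; rewrite setD0 => xP j jl; exact: y_Z0.
- by split=> // a; rewrite setDv inE.
Qed.

Lemma spanning_embedding : exists F : U -> V, injective F /\
  forall u, u != rt -> e (F (par u)) (F u).
Proof.
have [f0 [c0 pr0]] := initial_progress.
have [Us [Dm [f1 [c1 pr1]]]] := progress_all pr0 erefl.
have rm1 := room_progress pr1.
case: pr1 => st1 sUP sZD _ [lfD _ cov1].
pose Tg := ~: (lf @: Pl).
have TgP u : reflect (forall x, x \in Pl -> u != lf x) (u \in Tg).
  rewrite inE; apply: (iffP idP) => [uN x xP|uN].
    by apply: contraNneq uN => ->; rewrite imset_f.
  by apply/imsetP => -[x xP] /eqP; rewrite (negPf (uN x xP)).
have [|||f [c [st fE]]] := @state_fill _ _ _ _ Tg st1.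
- apply/subsetP => u uD; apply/TgP => x xP.
  by apply: contraTneq uD => ->; rewrite lfD.
- by move=> u _ urt; apply/TgP => x xP; exact: lf_leaf.
- rewrite cards0 addn0 cardsCs setCK (card_in_imset lf_inj).
  move: Pl_large m_gt0; rewrite /room -cardUV.
  have : #|Pl| <= #|U| := max_card _.
  by move: (g ^ S) (m.*2 * D); clear; lia.
have cTg : #|Tg| + #|Pl| = #|V|.
  rewrite cardsCs setCK (card_in_imset lf_inj) subnK ?cardUV //.
  by rewrite -cardUV max_card.
case: st => -[rTg _ injf ef] _ ext cTgD _; rewrite setU0 in ext.
have yTg : {in Pl, forall x, y x (len x) \in Tg}.
  move=> x xP; apply/TgP => x' x'P; rewrite eq_sym.
  by apply: lf_y; rewrite ?ltnSn.
have fy_inj : {in Pl &, injective (fun x => f (y x (len x)))}.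
  move=> x x' xP x'P /(injf _ _ (yTg x xP) (yTg x' x'P)).
  by move/(y_inj xP x'P (ltnSn _) (ltnSn _)) => -[].
have covA a : a \in A -> exists2 x, x \in Pl & f (y x (len x)) = a.
  move=> aA; have [|x xUs [yD <-]] := cov1 a; first by rewrite setD0.
  by exists x; [exact: (subsetP sUP) | rewrite fE].
pose W := ~: (f @: Tg).
have cW : #|W| = #|Pl|.
  by rewrite cardsCs setCK (card_in_imset injf) -cTg addKn.
have /card_gt0P[v0 _] : 0 < #|V| by rewrite -cardUV; apply/card_gt0P; exists rt.
have [|h injh hN] := @hall U V v0 Pl
    (fun x => [set w | e (f (y x (len x))) w] :&: W).
  move=> X sXP; set fX := [set f (y x (len x)) | x in X].
  have -> : nbhd (fun x => [set w | e (f (y x (len x))) w] :&: W) X =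
      nb e fX :&: W.
    apply/setP => w; rewrite in_setI; apply/nbhdP/andP.
      case=> x xX; rewrite in_setI inE => /andP[ew wW]; split=> //.
      by apply/nbP; exists (f (y x (len x))); rewrite ?imset_f.
    case=> /nbP[_ /imsetP[x xX ->] ew] wW; exists x => //.
    by rewrite in_setI inE ew.
  have cfX : #|fX| = #|X|.
    rewrite card_in_imset // => x x' xX x'X.
    by apply: fy_inj; exact: (subsetP sXP).
  have [leX|ltX] := leqP #|X| m.
    have := ext fX; rewrite cfX => /(_ (leq_trans leX _)).
    have -> : nb e fX :&: W = nb e fX :\: f @: Tg by rewrite setDE.
    move=> H; apply: leq_trans (H _); last by rewrite -addnn leq_addr.
    rewrite -cfX -sum1_card; apply: leq_sum => _ /imsetP[x xX ->].
    have := cTgD _ (yTg x (subsetP sXP x xX)); have := kids_bz Tg (y x (len x)).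
    by have := D_large; clear; lia.
  pose Y := W :\: nb e fX.
  have cY : #|Y| <= m.
    have := @join fX; rewrite cfX => /(_ (ltnW ltX)).
    have := cardsUI Y (nb e fX).
    have -> : Y :&: nb e fX = set0.
      by apply/setP => v; rewrite !inE; case: (v \in nb e fX); rewrite ?andbF.
    have : #|Y :|: nb e fX| <= #|V| := max_card _.
    by rewrite cards0; clear; lia.
  have leY : #|Y| <= #|Pl :\: X|.
    apply: leq_trans (A_dom cY) _.
    have sub : nb e Y :&: A \subset [set f (y x (len x)) | x in Pl :\: X].
      apply/subsetP => a; rewrite in_setI => /andP[/nbP[w wY ewa] aA].
      have [x xP aE] := covA a aA; apply/imsetP; exists x => //.
      rewrite inE xP andbT; apply/negP => xX.
      move: wY; rewrite inE => /andP[/negP[]]; apply/nbP.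
      by exists a; rewrite 1?e_sym // -aE imset_f.
    exact: leq_trans (subset_leq_card sub) (leq_imset_card _ _).
  have := cardsID (nb e fX) W; rewrite cW setIC -/Y.
  have := cardsID X Pl; rewrite (setIidPr sXP).
  by move: leY; clear; lia.
pose F u := if [pick x in Pl | lf x == u] is Some x then h x else f u.
have FTg u : u \in Tg -> F u = f u.
  move=> /TgP uN; rewrite /F; case: pickP => // x /andP[xP /eqP xE].
  by have := uN x xP; rewrite xE eqxx.
have FPl x : x \in Pl -> F (lf x) = h x.
  move=> xP; rewrite /F; case: pickP => [x' /andP[x'P /eqP/lf_inj->]|/(_ x)] //.
  by rewrite xP eqxx.
have hW x : x \in Pl -> h x \notin f @: Tg.
  by move=> /hN; rewrite in_setI => /andP[_]; rewrite inE.
have caseU u : u \in Tg \/ exists2 x, x \in Pl & u = lf x.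
  case: (boolP (u \in Tg)) => [|]; first by left.
  by rewrite inE negbK => /imsetP[x xP ->]; right; exists x.
exists F; split.
  move=> u u'; case: (caseU u) => [uT|[x xP ->]];
    case: (caseU u') => [u'T|[x' x'P ->]].
  - by rewrite !FTg //; exact: injf.
  - rewrite (FTg u) // FPl // => uE; have := hW x' x'P.
    by rewrite -uE imset_f.
  - rewrite (FTg u') // FPl // => uE; have := hW x xP.
    by rewrite uE imset_f.
  - by rewrite !FPl // => /(injh _ _ xP x'P)->.
move=> u urt; case: (caseU u) => [uT|[x xP uE]].
  rewrite !FTg ?ef //; apply/TgP => x xP; exact: lf_leaf.
rewrite uE FPl // lf_par // FTg ?yTg //.
by have := hN x xP; rewrite in_setI inE => /andP[].
Qed.

End Embedding.

(** * Vertical paths in rooted trees *)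

Lemma card_bigcup_leq (I T : finType) (A : {set I}) (F : I -> {set T}) k :
  {in A, forall i, #|F i| <= k} -> #|\bigcup_(i in A) F i| <= #|A| * k.
Proof.
move=> Fk; rewrite -sum_nat_const.
apply: (big_rec2 (fun (X : {set T}) l => #|X| <= l)); first by rewrite cards0.
move=> i l X iA leX; apply: leq_trans (leq_card_setU _ _) _.
exact: leq_add (Fk i iA) leX.
Qed.

Section RootedTree.

Variables (U : finType) (rt : U) (par : U -> U) (dep : U -> nat) (b : nat).
Hypothesis dep_rt : dep rt = 0.
Hypothesis dep_par : forall u, u != rt -> dep u = (dep (par u)).+1.
Hypothesis few_kids : forall u, #|[set v | (v != rt) && (par v == u)]| <= b.
Hypothesis b_gt1 : 1 < b.

Let b_gt0 : 0 < b. Proof. exact: ltnW. Qed.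

Lemma dep_eq0 u : dep u = 0 -> u = rt.
Proof. by move=> du; apply/eqP; apply: contra_eqT du => /dep_par->. Qed.

Lemma dep_gt0 u : 0 < dep u -> u != rt.
Proof. by apply: contraTneq => ->; rewrite dep_rt. Qed.

Lemma dep_iter t u : t <= dep u -> dep (iter t par u) = dep u - t.
Proof.
elim: t => [|t IHt] lt; first by rewrite subn0.
have dt := IHt (ltnW lt).
have := dep_par (dep_gt0 _ : iter t par u != rt); rewrite dt => /(_ _).
by rewrite subn_gt0 => /(_ lt); rewrite /= subnS => ->.
Qed.

(** [v] is [u] or a descendant of it. The depths fix the number of steps, since [par rt] is
    arbitrary and iterates beyond the root mean nothing. *)
Definition below v u := (dep u <= dep v) && (iter (dep v - dep u) par v == u).

Lemma below_refl u : below u u.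
Proof. by rewrite /below leqnn subnn /= eqxx. Qed.

Lemma below_dep v u : below v u -> dep u <= dep v.
Proof. by case/andP. Qed.

Lemma below_iter t v : t <= dep v -> below v (iter t par v).
Proof.
by move=> lt; rewrite /below dep_iter // leq_subr subKn // eqxx.
Qed.

Lemma belowP v u :
  reflect (exists2 t, t <= dep v & u = iter t par v) (below v u).
Proof.
apply: (iffP idP) => [/andP[le /eqP<-]|[t lt ->]]; last exact: below_iter.
by exists (dep v - dep u); rewrite ?leq_subr.
Qed.

Lemma below_trans u v w : below w v -> below v u -> below w u.
Proof.
case/belowP => t lt -> /belowP[t' lt' ->]; rewrite -iterD; apply: below_iter.
by move: lt'; rewrite dep_iter //; move: lt; clear; lia.
Qed.

Lemma below_rt u : below u rt.
Proof.
apply/belowP; exists (dep u) => //; apply/esym/dep_eq0.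
by rewrite dep_iter // subnn.
Qed.

Lemma below_eq v u : below v u -> dep v <= dep u -> v = u.
Proof.
by case/andP => le /eqP E le'; move: E; rewrite (_ : dep v - dep u = 0) //; lia.
Qed.

Lemma below_par v : v != rt -> below v (par v).
Proof. by move/dep_par => dv; apply: (@below_iter 1); rewrite dv. Qed.

Lemma below_parl v u : v != rt -> below v u -> v != u -> below (par v) u.
Proof.
move=> vrt /belowP[[|t] lt ->] vu; first by rewrite eqxx in vu.
rewrite iterSr; apply: below_iter; by move: lt; rewrite (dep_par vrt).
Qed.

Lemma below_total v u u' : below v u -> below v u' -> dep u' <= dep u ->
  below u u'.
Proof.
case/belowP => t lt -> /belowP[t' lt' ->]; rewrite !dep_iter // => le.
have -> : t' = (t' - t) + t by move: lt lt' le; clear; lia.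
by rewrite iterD; apply: below_iter; rewrite dep_iter //; move: lt lt'; clear; lia.
Qed.

Definition sub u := [set v | below v u].
Notation sz u := #|sub u|.

Lemma card_level t u : #|[set x | (t <= dep x) && (iter t par x == u)]| <= b ^ t.
Proof.
elim: t u => [|t IHt] u.
  rewrite expn0 -(cards1 u); apply: subset_leq_card; apply/subsetP => x.
  by rewrite !inE.
rewrite expnS; have := few_kids u; rewrite -(leq_pmul2r (_ : 0 < b ^ t)) ?expn_gt0 ?b_gt0 //.
apply: leq_trans.
apply: leq_trans (card_bigcup_leq (k := b ^ t) (A := [set v | (v != rt) && (par v == u)])
  (F := fun v => [set x | (t <= dep x) && (iter t par x == v)]) _); last first.
  by move=> v _; exact: IHt.
apply/subset_leq_card/subsetP => x; rewrite inE => /andP[lt xu].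
apply/bigcupP; exists (iter t par x); last by rewrite inE eqxx (ltnW lt).
rewrite inE -iterS xu andbT; apply: dep_gt0.
by rewrite dep_iter ?subn_gt0 // ltnW.
Qed.

Lemma card_top t u : #|[set x | below x u && (dep x < dep u + t)]| <= b ^ t.
Proof.
elim: t => [|t IHt].
  rewrite addn0 (_ : [set _ | _] = set0) ?cards0 //.
  by apply/setP => x; rewrite !inE; apply/negP => /andP[/below_dep]; clear; lia.
apply: (@leq_trans (b ^ t + b ^ t)); last first.
  by rewrite addnn -mul2n expnS leq_mul2r b_gt1 orbT.
apply: leq_trans (leq_add IHt (card_level t u)).
apply: leq_trans (leq_card_setU _ _); apply/subset_leq_card/subsetP => x.
rewrite !inE addnS ltnS => /andP[xu]; rewrite xu leq_eqVlt.
case/orP => [/eqP dx|->] //; rewrite dx leq_addl /=; apply/orP; right.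
by case/andP: xu => _; rewrite dx addKn.
Qed.

Lemma sz_step (v w : U) B : w != rt -> par w = v ->
  (forall w', w' != rt -> par w' = v -> w' != w -> sz w' <= B) ->
  sz v <= sz w + (1 + b * B).
Proof.
move=> wrt pw small.
have sub_v : sub v \subset [set v] :|: (sub w :|:
    \bigcup_(w' in [set w' | (w' != rt) && (par w' == v)] :\ w) sub w').
  apply/subsetP => x; rewrite !inE => xv; case: eqVneq => //= xnv.
  have [t lt vE] := belowP _ _ xv; case: t => [|t] in lt vE.
    by rewrite vE eqxx in xnv.
  have xt : below x (iter t par x) by apply: below_iter; exact: ltnW.
  have [<-|tw] := eqVneq (iter t par x) w; first by rewrite xt.
  apply/orP; right; apply/bigcupP; exists (iter t par x); last by rewrite inE.
  rewrite !inE tw -iterS -vE eqxx andbT; apply: dep_gt0.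
  by rewrite dep_iter ?subn_gt0 // ltnW.
apply: leq_trans (subset_leq_card sub_v) _.
apply: leq_trans (leq_card_setU _ _) _; rewrite cards1 addnCA leq_add2l.
apply: leq_trans (leq_card_setU _ _) _; rewrite leq_add2l.
apply: leq_trans (card_bigcup_leq (k := B) _) _.
  by move=> w'; rewrite !inE => /and3P[w'w w'rt /eqP pw']; exact: small.
rewrite leq_mul2r; apply/orP; right; apply: leq_trans (few_kids v).
exact/subset_leq_card/subD1set.
Qed.

(** What a rewiring of the path from [x] up to its [h]-th ancestor may affect: all that hangs from
    the path, except what lies strictly below [x]. *)
Definition region h x :=
  [set v | below v (iter h par x) && (~~ below v x || (v == x))].

Lemma card_region h x : h <= dep x -> #|region h x| + sz x = (sz (iter h par x)).+1.
Proof.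
move=> hx; have xt := below_iter hx.
have -> : region h x = x |: (sub (iter h par x) :\: sub x).
  apply/setP => v; rewrite !inE; case: eqVneq => [->|_] /=.
    by rewrite xt orbT.
  by rewrite orbF andbC.
rewrite cardsU1 !inE below_refl /= -(cardsID (sub x) (sub (iter h par x))).
rewrite (setIidPr _); first by clear; lia.
by apply/subsetP => v; rewrite !inE => vx; exact: below_trans vx xt.
Qed.

Definition candidates h B :=
  [set x | (h <= dep x) && (sz (iter h par x) <= sz x + B)].

Lemma region_iter h x z i : z \in region h x -> i <= dep z - dep (iter h par x) ->
  iter i par z \in region h x.
Proof.
rewrite !inE => /andP[zt zx] ile; have dz := below_dep zt.
have iz : i <= dep z by move: ile dz; clear; lia.
have zi := below_iter iz.
apply/andP; split; first by apply: below_total zi zt _; rewrite (dep_iter iz); move: ile dz; clear; lia.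
case: (boolP (below (iter i par z) x)) => //= ix.
have zbx := below_trans zi ix; rewrite zbx /= in zx.
rewrite (eqP zx) in ix *; apply/eqP; apply: below_eq ix _.
by rewrite (eqP zx) in iz; rewrite dep_iter // leq_subr.
Qed.

(** The way up from [z] to the top of the path stays in the region, so it has at most [B] steps. The
    top is thus one of [B.+1] ancestors of [z], and [x] one of at most [b ^ h] vertices [h] levels
    below it. *)
Lemma card_conflict h B z :
  #|[set x in candidates h B | z \in region h x]| <= B.+1 * b ^ h.
Proof.
rewrite -[B.+1]card_ord -cardsT.
apply: leq_trans (card_bigcup_leq (k := b ^ h)
  (F := fun t : 'I_B.+1 => [set x | (h <= dep x) && (iter h par x == iter t par z)]) _);
  last by move=> t _; exact: card_level.
apply/subset_leq_card/subsetP => x; rewrite !inE => /andP[/andP[hx szx] zR].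
have zt : below z (iter h par x) by case/andP: zR.
pose t := dep z - dep (iter h par x).
have tE : iter t par z = iter h par x by case/andP: zt => _ /eqP.
have tz : t <= dep z := leq_subr _ _.
have tB : t < B.+1.
  have inj : {in gtn t.+1 &, injective (fun i => iter i par z)}.
    move=> i j; rewrite !inE !ltnS => it jt E.
    have := congr1 dep E; rewrite !dep_iter ?(leq_trans it) ?(leq_trans jt) //.
    by move: it jt tz; clear; lia.
  have uq : uniq (mkseq (fun i => iter i par z) t.+1) by apply/mkseq_uniqP.
  have : size (mkseq (fun i => iter i par z) t.+1) <= #|region h x|.
    rewrite -(card_uniqP uq); apply/subset_leq_card/subsetP => v.
    case/mapP => i; rewrite mem_iota add0n ltnS => it ->.
    by apply: region_iter; rewrite // inE.
  by rewrite size_mkseq; have := card_region hx; move: szx; clear; lia.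
apply/bigcupP; exists (Ordinal tB); first by rewrite inE.
by rewrite inE hx /= tE eqxx.
Qed.

(** * Counting candidates through vertices with large subtrees *)

Section Counting.

Variable h : nat.

(** Call a vertex heavy if its subtree has more than [B] vertices. [H] is closed under [par]; [Bad]
    and [Min] are the branching vertices and the leaves of the heavy tree. There are two sources of
    candidates: in [C1] the whole subtree of the top is light; in [C2] no heavy branch leaves the
    path, so subtrees grow by at most [1 + b * B] per step. *)
Let B := b ^ h.+1.
Let H := [set v | B < sz v].
Let hc v := #|[set w in H | (w != rt) && (par w == v)]|.
Let Bad := [set v | 1 < hc v].
Let Min := [set v in H | hc v == 0].
Let C1 := [set x | (h <= dep x) && (sz (iter h par x) <= B)].
Let C2 := [set x in H | (h <= dep x) && [forall t : 'I_h, iter t.+1 par x \notin Bad]].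

Let sz_below u v : below u v -> sz u <= sz v.
Proof.
move=> uv; apply/subset_leq_card/subsetP => x; rewrite !inE => xu.
exact: below_trans xu uv.
Qed.

Let H_par w : w \in H -> w != rt -> par w \in H.
Proof.
rewrite !inE => wH wrt; apply: leq_trans wH (sz_below (below_par wrt)).
Qed.

Let Min_child v x : v \in Min -> below x v -> x != v -> sz x <= B.
Proof.
rewrite inE => /andP[_ /eqP/cards0_eq noH] /belowP[[|t] lt vE] xv.
  by rewrite vE eqxx in xv.
apply: leq_trans (sz_below (below_iter (ltnW lt))) _.
rewrite leqNgt; apply/negP => ltB; have /setP/(_ (iter t par x)) := noH.
rewrite !inE ltB -iterS -vE eqxx andbT /=; move/negbT; rewrite negbK => /eqP E.
by have := dep_iter (ltnW lt); rewrite E dep_rt; move: lt; clear; lia.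
Qed.

(** More than [b ^ h.+1] vertices below [v] force one at least [h + 1] levels down; its [h]-th
    ancestor is a proper descendant of [v], hence light. Distinct elements of [Min] are
    incomparable, so [g] is injective. *)
Let le_Min_C1 : #|Min| <= #|C1|.
Proof.
pose g v := if [pick x in C1 | below x v] is Some x then x else v.
have gP v : v \in Min -> g v \in C1 /\ below (g v) v.
  move=> vM; rewrite /g; case: pickP => [x /andP[]//|none].
  have : #|sub v| <= b ^ h.+1.
    apply: leq_trans (card_top h.+1 v); apply/subset_leq_card/subsetP => x.
    rewrite !inE => xv; rewrite xv ltnNge; apply/negP => dx.
    have hx : h <= dep x by move: dx; clear; lia.
    suff : (x \in C1) && below x v by rewrite none.
    rewrite inE hx xv andbT /=; apply: (Min_child vM).
      apply: below_total (below_iter hx) xv _.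
      by rewrite dep_iter //; move: dx; clear; lia.
    apply/eqP => E; have := congr1 dep E; rewrite dep_iter //.
    by move: dx; clear; lia.
  by move: vM; rewrite !inE => /andP[ltB _] leB; have := leq_trans ltB leB; rewrite ltnn.
have g_inj : {in Min &, injective g}.
  move=> v v' vM v'M E; have [_ gv] := gP v vM; have [_ gv'] := gP v' v'M.
  rewrite -E in gv'.
  wlog le : v v' vM v'M gv gv' E / dep v' <= dep v.
    move=> W; case: (leqP (dep v') (dep v)) => [|/ltnW]; first exact: W.
    by move=> le; apply/esym; apply: W => //; rewrite -E.
  have vv' := below_total gv gv' le.
  apply/eqP; apply: contraT => nv; have := Min_child v'M vv' nv.
  by move: vM; rewrite !inE => /andP[ltB _] leB; have := leq_trans ltB leB; rewrite ltnn.
rewrite -(card_in_imset g_inj); apply/subset_leq_card/subsetP => _ /imsetP[v vM ->].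
by have [] := gP v vM.
Qed.

(** [hc] has average at most 1 over [H], so values above 1 are balanced by zeros. *)
Let le_Bad_Min : #|Bad| <= #|Min|.
Proof.
have hcH v : 0 < hc v -> v \in H.
  by rewrite card_gt0 => /set0Pn[w]; rewrite inE => /and3P[wH wrt /eqP<-]; exact: H_par.
have sumhc : \sum_(v in H) hc v <= #|H|.
  have -> : \sum_(v in H) hc v = #|[set w in H | w != rt]|.
    have side w : w \in [set w in H | w != rt] -> mem H (par w).
      by move=> /setIdP[wH wrt]; exact: H_par.
    rewrite -sum1_card (partition_big par (mem H) side) /=.
    apply: eq_bigr => v _; rewrite sum1_card; apply: eq_card => w.
    by rewrite [RHS]/in_mem /= !inE -?andbA.
  by apply/subset_leq_card/subsetP => w; rewrite inE => /andP[].
have cardE' (X : {set U}) : X \subset H -> #|X| = \sum_(v in H) (v \in X : nat).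
  move=> sX; rewrite -sum1_card [LHS]big_mkcond [RHS]big_mkcond /=.
  apply: eq_bigr => v _; case: (boolP (v \in X)) => [/(subsetP sX)->|] //=.
  by case: ifP.
have : #|H| + #|Bad| <= \sum_(v in H) hc v + #|Min|.
  rewrite (cardE' H) // (cardE' Bad); last first.
    by apply/subsetP => v; rewrite inE => ltv; apply: hcH; exact: ltnW.
  rewrite (cardE' Min); last by apply/subsetP => v; rewrite inE => /andP[].
  rewrite -!big_split /=; apply: leq_sum => v vH; rewrite vH [v \in Bad]inE.
  rewrite [v \in Min]inE vH /=; case: (hc v) => [|[|k]] //=.
by move: sumhc; clear; lia.
Qed.

(** A heavy vertex outside [C2] lies in the top [h] levels or at most [h] levels below a vertex of
    [Bad]. *)
Let card_H : #|H| <= #|C2| + b ^ h + #|Bad| * b ^ h.+1.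
Proof.
pose X0 := [set x | below x rt && (dep x < dep rt + h)].
pose X1 := \bigcup_(u in Bad) [set x | below x u && (dep x < dep u + h.+1)].
have leX1 : #|X1| <= #|Bad| * b ^ h.+1.
  by apply: card_bigcup_leq => u _; exact: card_top.
apply: leq_trans (leq_add (leq_add (leqnn _) (card_top h rt)) leX1).
apply: (@leq_trans #|C2 :|: X0 :|: X1|); last first.
  apply: leq_trans (leq_card_setU _ _) _; rewrite leq_add2r.
  exact: leq_card_setU.
apply/subset_leq_card/subsetP => x xH; rewrite in_setU in_setU.
have [ltx|lex] := ltnP (dep x) h.
  by rewrite [x \in X0]inE below_rt dep_rt add0n ltx orbT.
case: (boolP [forall t : 'I_h, iter t.+1 par x \notin Bad]) => [good|].
  by rewrite [x \in C2]inE xH lex good.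
rewrite negb_forall => /existsP[t]; rewrite negbK => tB.
have tx : t.+1 <= dep x by apply: leq_trans (ltn_ord t) lex.
apply/orP; right; apply/bigcupP; exists (iter t.+1 par x) => //.
rewrite inE below_iter // dep_iter //=.
by have := ltn_ord t; move: tx; clear; lia.
Qed.

Let card_all : #|U| <= #|C1| + b ^ h + #|H| * b ^ h.
Proof.
pose X0 := [set x | below x rt && (dep x < dep rt + h)].
pose X1 := \bigcup_(u in H) [set x | (h <= dep x) && (iter h par x == u)].
have leX1 : #|X1| <= #|H| * b ^ h.
  by apply: card_bigcup_leq => u _; exact: card_level.
apply: leq_trans (leq_add (leq_add (leqnn _) (card_top h rt)) leX1).
apply: (@leq_trans #|C1 :|: X0 :|: X1|); last first.
  apply: leq_trans (leq_card_setU _ _) _; rewrite leq_add2r.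
  exact: leq_card_setU.
rewrite -cardsT; apply/subset_leq_card/subsetP => x _; rewrite in_setU in_setU.
have [ltx|lex] := ltnP (dep x) h.
  by rewrite [x \in X0]inE below_rt dep_rt add0n ltx orbT.
have [lez|ltz] := leqP (sz (iter h par x)) B.
  by rewrite [x \in C1]inE lex lez.
apply/orP; right; apply/bigcupP; exists (iter h par x); first by rewrite inE.
by rewrite inE lex eqxx.
Qed.

Let C2_sz x : x \in C2 -> sz (iter h par x) <= sz x + h * (1 + b * B).
Proof.
rewrite inE => /and3P[xH hx /forallP noBad].
suff W : forall t, t <= h -> sz (iter t par x) <= sz x + t * (1 + b * B)
    /\ iter t par x \in H by have [] := W h (leqnn h).
elim=> [_|t IHt lt]; first by rewrite mul0n addn0.
have [le1 tH] := IHt (ltnW lt).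
have trt : iter t par x != rt.
  by apply: dep_gt0; rewrite dep_iter ?subn_gt0 ?(leq_trans lt) // (leq_trans (ltnW lt)).
split; last exact: H_par.
have := noBad (Ordinal lt); rewrite inE -leqNgt => hc1.
have := @sz_step (iter t.+1 par x) (iter t par x) B trt erefl.
suff W : forall w', w' != rt -> par w' = iter t.+1 par x ->
    w' != iter t par x -> sz w' <= B.
  by move=> /(_ W); rewrite mulSn; move: le1; clear; lia.
move=> w' w'rt pw' w'n; rewrite leqNgt; apply/negP => w'H.
suff : 1 < hc (iter t.+1 par x) by rewrite ltnNge hc1.
rewrite -[2]/(1.+1) -(_ : #|[set w'; iter t par x]| = 2); last by rewrite cards2 w'n.
apply/subset_leq_card/subsetP => z; rewrite !inE.
by case/orP => /eqP->; rewrite ?w'H ?w'rt ?pw' ?trt ?eqxx //= andbT; move: tH; rewrite inE.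
Qed.

(** By [le_Bad_Min] and [le_Min_C1] the counts combine to [n <= K + q + (K + q + K b q) q] with
    [q = b ^ h]. A large [n] excludes [K = 0], and then every term is absorbed by a multiple of
    [K]. *)
Lemma many_candidates : 2 * b ^ (2 * h + 3) <= #|U| ->
  #|U| <= #|candidates h (b ^ (2 * h + 3))| * b ^ (2 * h + 4).
Proof.
move=> U_large; set K := #|candidates _ _|.
have hb : h <= b ^ h by apply: ltnW; exact: ltn_expl.
have Bb : h * (1 + b * B) <= b ^ (2 * h + 3).
  have -> : b ^ (2 * h + 3) = b ^ h * (b * (b * B)).
    by rewrite /B -!expnS -expnD; congr (_ ^ _); clear; lia.
  apply: leq_mul => //; have : 0 < b * B by rewrite muln_gt0 b_gt0 expn_gt0 b_gt0.
  by move: (b * B) b_gt1; clear; nia.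
have BB : B <= b ^ (2 * h + 3) by rewrite leq_pexp2l //; clear; lia.
have K1 : #|C1| <= K.
  apply/subset_leq_card/subsetP => x; rewrite !inE => /andP[-> le] /=.
  by apply: leq_trans le _; apply: leq_trans BB _; exact: leq_addl.
have K2 : #|C2| <= K.
  apply/subset_leq_card/subsetP => x xC; have := C2_sz xC.
  move: xC; rewrite !inE => /and3P[_ -> _] /= le.
  by apply: leq_trans le _; rewrite leq_add2l.
have leMin := leq_trans le_Bad_Min (leq_trans le_Min_C1 K1).
have E1 : b ^ h.+1 = b * b ^ h by rewrite expnS.
have E2 : b ^ (2 * h + 3) = b * b * b * (b ^ h * b ^ h).
  by rewrite -expnD -!mulnA -!expnS; congr (_ ^ _); clear; lia.
have E3 : b ^ (2 * h + 4) = b * b ^ (2 * h + 3).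
  by rewrite -expnS; congr (_ ^ _); clear; lia.
have q_gt0 : 0 < b ^ h by rewrite expn_gt0 b_gt0.
move: card_all card_H U_large; rewrite E3 E2 E1.
move: (b ^ h) q_gt0 #|C1| K1 #|C2| K2 #|H| #|Bad| leMin #|U| b_gt1.
move: K b; clear=> K b q q_gt0 C1 K1 C2 K2 H Bad KB n b_gt1 le_n le_H n_large.
have le_H' : H <= K + q + K * (b * q).
  apply: leq_trans le_H _; rewrite leq_add ?leq_add2r // leq_mul2r KB; exact: orbT.
have le_n' : n <= K + q + (K + q + K * (b * q)) * q.
  apply: leq_trans le_n _; rewrite leq_add ?leq_add2r // leq_mul2r le_H'; exact: orbT.
have qq : q <= q * q by rewrite leq_pmulr.
have b3 : 8 <= b * b * b by nia.
have Q8 : 8 * (q * q) <= b * b * b * (q * q) by rewrite leq_mul2r b3 orbT.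
case: K {KB K1 K2 le_H le_n} => [|K] in le_H' le_n' *.
  by move: le_n'; rewrite !mul0n !add0n addn0; lia.
have le1 : n <= K.+1 * (4 * (q * q) + b * (q * q)).
  by apply: leq_trans le_n' _; nia.
apply: leq_trans le1 _; rewrite leq_mul2l /=.
have -> : b * (b * b * b * (q * q)) = (b * b * b) * (b * (q * q)) by nia.
have : 8 * (b * (q * q)) <= b * b * b * (b * (q * q)) by rewrite leq_mul2r b3 orbT.
by nia.
Qed.

End Counting.

(** * Disjoint places of all scales *)

Definition reg s x := region (2 * s + 3) x.
Definition cand s := candidates (2 * s + 3) (b ^ (2 * (2 * s + 3) + 3)).

(** [beta ^ s] has to bound region sizes, conflicts and the inverse density of candidates for all
    [s >= 1]. With [h = 2 s + 3] the largest is the number of conflicts,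
    [b ^ (2 h + 4) * b ^ h = b ^ (6 s + 13)], whence 19. *)
Let beta := b ^ 19.

Lemma cand_dep s x : x \in cand s -> 2 * s + 3 <= dep x.
Proof. by rewrite inE => /andP[]. Qed.

Lemma mem_reg s x : x \in cand s -> x \in reg s x.
Proof. by move/cand_dep => hx; rewrite inE below_iter //= eqxx orbT. Qed.

Lemma succ_expn_leq k : (b ^ k).+1 <= b ^ k.+1.
Proof.
rewrite expnS; have : 0 < b ^ k by rewrite expn_gt0 b_gt0.
by move: (b ^ k) b_gt1; clear; nia.
Qed.

Lemma card_reg s x : 0 < s -> x \in cand s -> #|reg s x| <= beta ^ s.
Proof.
move=> s_gt0; rewrite inE => /andP[hx szx]; have := card_region hx.
rewrite -/(reg s x) => E.
apply: (@leq_trans (b ^ (2 * (2 * s + 3) + 3)).+1).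
  by move: E szx; clear; lia.
apply: leq_trans (succ_expn_leq _) _; rewrite -expnM leq_pexp2l //.
by move: s_gt0; clear; lia.
Qed.

Lemma card_cand_conflict s z : 0 < s ->
  #|[set x in cand s | z \in reg s x]| <= beta ^ s.
Proof.
move=> s_gt0; apply: leq_trans (card_conflict _ _ _) _.
apply: leq_trans (leq_mul (succ_expn_leq _) (leqnn _)) _.
rewrite -expnD -expnM leq_pexp2l //.
by move: s_gt0; clear; lia.
Qed.

Definition family (Pl : {set U}) (sc : U -> nat) : Prop :=
  {in Pl, forall x, x \in cand (sc x)} /\
  {in Pl &, forall x x' z, z \in reg (sc x) x -> z \in reg (sc x') x' -> x = x'}.

Definition covered (Pl : {set U}) (sc : U -> nat) : {set U} :=
  \bigcup_(x in Pl) reg (sc x) x.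

Lemma free_place s (Om : {set U}) : 0 < s -> #|Om| * beta ^ s < #|cand s| ->
  exists2 x, x \in cand s & {in Om, forall z, z \notin reg s x}.
Proof.
move=> s_gt0 lt.
pose X := \bigcup_(z in Om) [set x in cand s | z \in reg s x].
have leX : #|X| <= #|Om| * beta ^ s.
  by apply: card_bigcup_leq => z _; exact: card_cand_conflict.
have : ~~ (cand s \subset X).
  by apply/negP => /subset_leq_card le; have := leq_trans lt (leq_trans le leX); rewrite ltnn.
case/subsetPn => x xc xX; exists x => // z zO; apply/negP => zx.
by case/negP: xX; apply/bigcupP; exists z; rewrite // inE xc.
Qed.

Lemma add_places s M Pl sc : 0 < s -> family Pl sc ->
  (#|covered Pl sc| + M * beta ^ s) * beta ^ s < #|cand s| ->
  exists Pl' sc', [/\ family Pl' sc',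
    #|covered Pl' sc'| <= #|covered Pl sc| + M * beta ^ s,
    forall s', #|[set x in Pl | sc x == s']| + (s' == s) * M <=
               #|[set x in Pl' | sc' x == s']| &
    {in Pl', forall x, sc' x = s \/ x \in Pl /\ sc' x = sc x}].
Proof.
move=> s_gt0; elim: M => [|M IHM] in Pl sc * => fam lt.
  exists Pl, sc; split=> //; first by rewrite leq_addr.
    by move=> s'; rewrite muln0 addn0.
  by move=> x xP; right.
have [|x xc xfree] := @free_place s (covered Pl sc) s_gt0.
  by apply: leq_ltn_trans lt; rewrite leq_mul2r leq_addr orbT.
have xP : x \notin Pl.
  apply/negP => xP; have := xfree x; rewrite mem_reg // => /(_ _)/negP[] //.
  by apply/bigcupP; exists x => //; apply/mem_reg/(proj1 fam).
pose sc1 z := if z == x then s else sc z.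
have sc1x : sc1 x = s by rewrite /sc1 eqxx.
have sc1P z : z \in Pl -> sc1 z = sc z.
  by move=> zP; rewrite /sc1; case: eqVneq zP xP => // -> ->.
have fam1 : family (x |: Pl) sc1.
  case: fam => famc famd; split.
    move=> z; rewrite in_setU1 => /orP[/eqP->|zP]; first by rewrite sc1x.
    by rewrite sc1P // famc.
  move=> z z'; rewrite !in_setU1 => /orP[/eqP->|zP] /orP[/eqP->|z'P] // w.
  - rewrite sc1x sc1P // => wx wz'.
    have wO : w \in covered Pl sc by apply/bigcupP; exists z'.
    by rewrite (negPf (xfree w wO)) in wx.
  - rewrite sc1x sc1P // => wz wx.
    have wO : w \in covered Pl sc by apply/bigcupP; exists z.
    by rewrite (negPf (xfree w wO)) in wx.
  - by rewrite !sc1P //; exact: famd.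
have cov1 : #|covered (x |: Pl) sc1| <= #|covered Pl sc| + beta ^ s.
  apply: (@leq_trans #|covered Pl sc :|: reg s x|).
    apply/subset_leq_card/subsetP => z /bigcupP[w].
    rewrite in_setU1 in_setU => /orP[/eqP->|wP]; first by rewrite sc1x => ->; rewrite orbT.
    by rewrite sc1P // => zw; apply/orP; left; apply/bigcupP; exists w.
  apply: leq_trans (leq_card_setU _ _) _; rewrite leq_add2l.
  exact: card_reg.
have [|Pl' [sc' [fam' cov' cnt' scP']]] := IHM _ _ fam1.
  apply: leq_ltn_trans lt; rewrite leq_mul2r mulSn addnA leq_add2r cov1.
  exact: orbT.
exists Pl', sc'; split=> //.
- by apply: leq_trans cov' _; rewrite mulSn addnA leq_add2r.
- move=> s'; apply: leq_trans (cnt' s'); rewrite mulnS addnA leq_add2r.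
  case: (eqVneq s' s) => [->|ns]; last first.
    rewrite addn0; apply/subset_leq_card/subsetP => z; rewrite !inE => /andP[zP].
    by rewrite zP orbT sc1P.
  rewrite addn1; apply: (@leq_trans #|x |: [set z in Pl | sc z == s]|).
    by rewrite cardsU1 inE (negPf xP).
  apply/subset_leq_card/subsetP => z; rewrite !inE.
  case/orP => [/eqP->|/andP[zP sz]]; first by rewrite eqxx sc1x eqxx.
  by rewrite zP orbT sc1P.
- move=> z /scP'[->|[]]; first by left.
  rewrite in_setU1 => /orP[/eqP->|zP] ->; first by left; rewrite sc1x.
  by right; rewrite sc1P.
Qed.

(** Scales are served from [S] down to 1, so before scale [s] at most
    [kap * g ^ (S.+1 - s) * beta ^ s] vertices are covered. Each new region covers [beta ^ s]
    vertices at most, and each covered vertex spoils at most [beta ^ s] of the at least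
    [#|U| / beta ^ s] candidates. These three factors are the reason for [beta ^ 3 <= g]. *)
Lemma place_family g S kap : beta ^ 3 <= g -> 0 < kap ->
  2 * kap * g ^ S.+1 < #|U| ->
  exists Pl sc, [/\ family Pl sc, {in Pl, forall x, 0 < sc x <= S} &
    forall s, 0 < s <= S -> kap * g ^ (S.+1 - s) <= #|[set x in Pl | sc x == s]|].
Proof.
move=> gbeta kap_gt0 U_large.
have beta_gt1 : 1 < beta by rewrite -(exp1n 19) ltn_exp2r.
have beta_gt0 := ltnW beta_gt1.
have g2 : 2 * beta <= g.
  by apply: leq_trans gbeta; rewrite !expnS expn0; move: beta beta_gt1; clear; nia.
have g_gt0 : 0 < g by move: g2 beta_gt0; clear; lia.
suff W k : k <= S -> exists Pl sc, [/\ family Pl sc,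
    #|covered Pl sc| <= kap * g ^ k.+1 * beta ^ (S - k),
    {in Pl, forall x, S - k < sc x <= S} &
    forall s, S - k < s <= S ->
      kap * g ^ (S.+1 - s) <= #|[set x in Pl | sc x == s]|].
  have [Pl [sc [fam _ scP cnt]]] := W S (leqnn S).
  by rewrite subnn in scP cnt; exists Pl, sc.
elim: k => [_|k IHk ltk].
  exists set0, (fun=> 0); split.
  - by split=> [x|x x']; rewrite inE.
  - by rewrite /covered big_set0 cards0.
  - by move=> x; rewrite inE.
  - by move=> s; rewrite subn0; case: ltngtP.
have [Pl [sc [fam cov scP cnt]]] := IHk (ltnW ltk).
have s_gt0 : 0 < S - k by rewrite subn_gt0.
pose s := S - k; have s0 : 0 < s by [].
have betas : 2 * (kap * g ^ k.+1 * beta ^ s) * beta ^ s * beta ^ s < #|U|.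
  apply: leq_ltn_trans U_large.
  have -> : 2 * (kap * g ^ k.+1 * beta ^ s) * beta ^ s * beta ^ s =
     2 * kap * (g ^ k.+1 * (beta ^ s * (beta ^ s * beta ^ s))) by clear; lia.
  rewrite leq_mul2l; apply/orP; right.
  have -> : S.+1 = k.+1 + s by rewrite /s addSn subnKC // ltnW.
  rewrite expnD leq_mul2l; apply/orP; right.
  rewrite -!expnD (_ : s + (s + s) = 3 * s); last by clear; lia.
  by rewrite expnM leq_exp2r.
have bs_gt0 : 0 < beta ^ s by rewrite expn_gt0 beta_gt0.
have gk_gt0 : 0 < g ^ k.+1 by rewrite expn_gt0 g_gt0.
have many : #|U| <= #|cand s| * beta ^ s.
  apply: leq_trans (@many_candidates (2 * s + 3) _) _.
    apply: leq_trans (ltnW betas).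
    apply: (@leq_trans (2 * beta ^ s)).
      rewrite leq_mul2l /= -expnM leq_pexp2l //.
      by move: (s) s0; clear; lia.
    move: (beta ^ s) bs_gt0 (g ^ k.+1) gk_gt0 kap_gt0 => q q0 r r0 kp0.
    have -> : 2 * (kap * r * q) * q * q = 2 * q * (kap * r * q * q) by clear; lia.
    by rewrite leq_pmulr // !muln_gt0 kp0 r0 q0.
  rewrite leq_mul2l; apply/orP; right; rewrite -expnM leq_pexp2l //.
  by move: (s) s0; clear; lia.
have [|Pl' [sc' [fam' cov' cnt' scP']]] :=
    @add_places s (kap * g ^ k.+1) Pl sc s_gt0 fam.
  rewrite -(ltn_pmul2r bs_gt0); apply: leq_trans many.
  apply: leq_ltn_trans betas; rewrite !leq_mul2r; apply/orP; right; apply/orP; right.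
  by rewrite mul2n -addnn leq_add2r.
have sk : S - k.+1 = s.-1 by rewrite /s subnS.
exists Pl', sc'; split=> //.
- apply: leq_trans cov' _; apply: (@leq_trans (kap * g ^ k.+1 * (2 * beta ^ s))).
    by rewrite mul2n -addnn mulnDr leq_add2r.
  rewrite [g ^ k.+2]expnSr -!mulnA !leq_mul2l; apply/orP; right; apply/orP; right.
  by rewrite sk -[s in beta ^ s](prednK s_gt0) expnS mulnA leq_mul2r g2 orbT.
- move=> x /scP'[->|[xP ->]]; first by rewrite sk ltn_predL s_gt0 /s leq_subr.
  case/andP: (scP x xP) => lt ->; rewrite andbT; apply: leq_ltn_trans lt.
  by rewrite leq_sub2l.
- move=> s' /andP[lts les]; case: (eqVneq s' s) => [E|ns].
    apply: leq_trans (cnt' s'); rewrite E eqxx mul1n.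
    by rewrite [S.+1 - s](_ : _ = k.+1) ?leq_addl // /s; move: ltk; clear; lia.
  apply: leq_trans (cnt' s'); apply: leq_trans (leq_addr _ _); apply: cnt.
  rewrite les andbT; move: lts ns; rewrite sk -/s; move: (s) s0; clear; lia.
Qed.

(** * Rewiring the vertical paths *)

Section Zigzag.

Variables (Pl : {set U}) (sc : U -> nat) (S : nat).
Hypothesis fam : family Pl sc.
Hypothesis sc_range : {in Pl, forall x, 0 < sc x <= S}.

Definition path_len x := 2 * sc x + 3.
Definition path_pt x i := iter (path_len x - i) par x.

Lemma pt_dep x i : x \in Pl -> i <= path_len x -> dep (path_pt x i) = dep (path_pt x 0) + i.
Proof.
move=> xP ih; have hx := cand_dep ((proj1 fam) x xP); rewrite -/(path_len x) in hx.
rewrite /path_pt subn0 !dep_iter //; last by apply: leq_trans (leq_subr _ _) hx.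
by move: hx ih; clear; lia.
Qed.

Lemma pt_par x i : i < path_len x -> par (path_pt x i.+1) = path_pt x i.
Proof. by move=> ih; rewrite /path_pt -iterS subnSK. Qed.

Lemma pt_end x : path_pt x (path_len x) = x.
Proof. by rewrite /path_pt subnn. Qed.

Lemma end_dep x : x \in Pl -> dep x = dep (path_pt x 0) + path_len x.
Proof. by move=> xP; rewrite -(pt_dep xP (leqnn _)) pt_end. Qed.

Lemma pt_reg x i : x \in Pl -> i <= path_len x -> path_pt x i \in reg (sc x) x.
Proof.
move=> xP ih; have xc := (proj1 fam) x xP; have hx := cand_dep xc.
apply: region_iter; first exact: mem_reg.
rewrite dep_iter // subKn // -/(path_len x); exact: leq_subr.
Qed.

Lemma pt_rt x i : x \in Pl -> 0 < i <= path_len x -> path_pt x i != rt.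
Proof.
move=> xP /andP[i0 ih]; apply: dep_gt0; rewrite pt_dep //.
by apply: leq_trans i0 (leq_addl _ _).
Qed.

Lemma reg_inj x x' v : x \in Pl -> x' \in Pl -> v \in reg (sc x) x ->
  v \in reg (sc x') x' -> x = x'.
Proof. by move=> xP x'P; exact: (proj2 fam). Qed.

Lemma pt_inj x x' i i' : x \in Pl -> x' \in Pl -> i <= path_len x -> i' <= path_len x' ->
  path_pt x i = path_pt x' i' -> x = x' /\ i = i'.
Proof.
move=> xP x'P ih ih' E.
have xx' : x = x'.
  by apply: (reg_inj xP x'P (pt_reg xP ih)); rewrite E pt_reg.
rewrite -xx' in E ih' *; split=> //; have := congr1 dep E.
by rewrite (pt_dep xP ih) (pt_dep xP ih') => /addnI.
Qed.

Lemma below_reg x v : x \in Pl -> below v (path_pt x 0) -> ~~ below v x ->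
  v \in reg (sc x) x.
Proof. by move=> xP v0 vx; rewrite inE vx andbT; move: v0; rewrite /path_pt subn0. Qed.

Lemma kid_dep x v : x \in Pl -> v != rt -> par v = path_pt x (sc x).+1 ->
  dep v = dep (path_pt x 0) + (sc x).+2.
Proof.
move=> xP vrt pv; rewrite dep_par // pv pt_dep ?addnS //.
by rewrite /path_len; clear; lia.
Qed.

Lemma kid_reg x v : x \in Pl -> v != rt -> par v = path_pt x (sc x).+1 ->
  v \in reg (sc x) x.
Proof.
move=> xP vrt pv; have dv := kid_dep xP vrt pv; apply: below_reg => //.
  apply: below_trans (below_par vrt) _; rewrite pv.
  have := pt_reg xP (_ : (sc x).+1 <= path_len x); rewrite inE /path_pt subn0 => /(_ _)/andP[] //.
  by rewrite /path_len; clear; lia.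
apply/negP => /below_dep; rewrite (end_dep xP) dv /path_len.
by clear; lia.
Qed.

(** The vertices whose parent is changed by the place [x]. *)
Definition hit x v := [exists i : 'I_(path_len x), v == path_pt x i.+1] ||
  ((v != rt) && (par v == path_pt x (sc x).+1)).

(** For [i > 0], the index of the predecessor of the [i]-th vertex in zigzag order; the bottom
    vertex is sent to the top. *)
Definition npar x i := if i == path_len x then 0
  else if i <= (sc x).+1 then path_len x - i else path_len x - i.+1.

Definition newpar x v := let i := dep v - dep (path_pt x 0) in
  if v == path_pt x i then path_pt x (npar x i) else path_pt x (sc x).+2.

(* The path [p_0 p_1 ... p_h], [h = 2 s + 3], is rewired to the pendant path
   [p_0 p_(h-1) p_1 p_(h-2) p_2 ...], which ends with [p_(s+2) p_(s+1)]; the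
   bottom vertex [p_h] hangs from [p_0], and the remaining children of
   [p_(s+1)] hang from [p_(s+2)], so that [p_(s+1)] becomes a leaf. *)
Definition parZ v := if [pick x in Pl | hit x v] is Some x then newpar x v
  else par v.

Lemma hit_reg x v : x \in Pl -> hit x v -> v \in reg (sc x) x.
Proof.
move=> xP /orP[/existsP[i /eqP->]|/andP[vrt /eqP pv]]; last exact: kid_reg.
by apply: pt_reg.
Qed.

Lemma parZ_hit x v : x \in Pl -> hit x v -> parZ v = newpar x v.
Proof.
move=> xP hx; rewrite /parZ; case: pickP => [x' /andP[x'P hx']|/(_ x)].
  by rewrite (reg_inj xP x'P (hit_reg xP hx) (hit_reg x'P hx')).
by rewrite xP hx.
Qed.

Lemma parZ_path x i : x \in Pl -> 0 < i <= path_len x ->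
  parZ (path_pt x i) = path_pt x (npar x i).
Proof.
move=> xP /andP[i0 ih]; rewrite (parZ_hit xP).
  by rewrite /newpar pt_dep // addKn eqxx.
apply/orP; left; have i1 : i.-1 < path_len x by rewrite prednK.
by apply/existsP; exists (Ordinal i1); rewrite /= prednK.
Qed.

Lemma parZ_kid x v : x \in Pl -> v != rt -> par v = path_pt x (sc x).+1 ->
  v != path_pt x (sc x).+2 -> parZ v = path_pt x (sc x).+2.
Proof.
move=> xP vrt pv vn; rewrite (parZ_hit xP); last first.
  by apply/orP; right; rewrite vrt pv eqxx.
by rewrite /newpar (kid_dep xP vrt pv) addKn (negPf vn).
Qed.

Variant parZ_spec v : U -> Prop :=
  | ParZPath x i of x \in Pl & 0 < i <= path_len x & v = path_pt x i :
      parZ_spec v (path_pt x (npar x i))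
  | ParZKid x of x \in Pl & par v = path_pt x (sc x).+1 & v != path_pt x (sc x).+2 :
      parZ_spec v (path_pt x (sc x).+2)
  | ParZOther of {in Pl, forall x, ~~ hit x v} : parZ_spec v (par v).

Lemma parZP v : v != rt -> parZ_spec v (parZ v).
Proof.
move=> vrt; case: (boolP [exists x in Pl, hit x v]); last first.
  rewrite negb_exists_in => /forall_inP none.
  have -> : parZ v = par v; last exact: ParZOther.
  rewrite /parZ; case: pickP => // x /andP[xP hx].
  by rewrite (negPf (none x xP)) in hx.
case/exists_inP => x xP /orP[/existsP[i /eqP->]|/andP[_ /eqP pv]].
  have ih : 0 < i.+1 <= path_len x by rewrite /= ltn_ord.
  by rewrite parZ_path //; exact: ParZPath ih erefl.
have [vE|vn] := eqVneq v (path_pt x (sc x).+2).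
  have ih : 0 < (sc x).+2 <= path_len x by rewrite /path_len; clear; lia.
  by rewrite vE parZ_path //; exact: ParZPath ih erefl.
by rewrite (parZ_kid xP) //; exact: ParZKid.
Qed.

Lemma npar_neq x i : 0 < i <= path_len x -> npar x i != (sc x).+1.
Proof.
rewrite /npar; case: (eqVneq i (path_len x)) => // ne /andP[i0 ih]; rewrite /path_len in ne ih *.
by case: (leqP i (sc x).+1) => /=; move: ne i0 ih; clear; lia.
Qed.

Lemma npar_leq x i : npar x i <= path_len x.
Proof. by rewrite /npar; case: eqVneq => // _; case: (leqP i _) => _; rewrite leq_subr. Qed.

(** Edges of the original tree span at most two edges of the new one: [p_(i-1)] and [p_i] are both
    next to [p_(h-i)], except that [p_(s+1)] and [p_(s+2)] are adjacent; a child of [p_(s+1)] that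
    moved to [p_(s+2)] is two steps away from [p_(s+1)]. *)
Lemma zigzag_near (T : Type) (E : rel T) (f : U -> T) : symmetric E ->
  (forall u, u != rt -> E (f (parZ u)) (f u)) ->
  forall v, v != rt -> E (f (par v)) (f v) \/
    exists w, E (f (par v)) w /\ E w (f v).
Proof.
move=> E_sym fE v vrt; have Ev := fE v vrt; move: (Ev).
case: parZP => // [x i xP ih vE|x xP pv vn|_] EvZ; last by left.
- have Ep j : 0 < j <= path_len x -> E (f (path_pt x (npar x j))) (f (path_pt x j)).
    by move=> jh; rewrite -parZ_path // fE // pt_rt.
  have pv : par v = path_pt x i.-1.
    by rewrite vE; case/andP: ih; case: (i) => // j _ jh; rewrite pt_par.
  rewrite pv vE; case/andP: (ih) => i0 ile.
  have hE : path_len x = 2 * sc x + 3 by [].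
  have [i_top|ni] := eqVneq i (path_len x).
    right; exists (f (path_pt x 0)); split; last first.
      by have := Ep i ih; rewrite /npar i_top eqxx.
    have := Ep i.-1; rewrite /npar E_sym ifF; last by move: i_top hE; clear; lia.
    rewrite ifF; last by move: i_top hE; clear; lia.
    rewrite (_ : path_len x - i.-1.+1 = 0); last by move: i_top hE; clear; lia.
    by apply; move: i_top hE; clear; lia.
  have [i_low|i_high] := leqP i (sc x).+1.
    right; exists (f (path_pt x (path_len x - i))); split; last first.
      by have := Ep i ih; rewrite /npar (negPf ni) i_low.
    have := Ep (path_len x - i); rewrite /npar ifF; last by move: i0 hE; clear; lia.
    rewrite ifF; last by move: i_low hE; clear; lia.
    rewrite (_ : path_len x - (path_len x - i).+1 = i.-1); last by move: i0 ile hE; clear; lia.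
    by apply; move: i0 i_low hE; clear; lia.
  have [i_mid|ni'] := eqVneq i (sc x).+2.
    left; have := Ep i.-1; rewrite E_sym /npar ifF; last by move: i_mid hE; clear; lia.
    rewrite ifT; last by move: i_mid hE; clear; lia.
    rewrite (_ : path_len x - i.-1 = i); last by move: i_mid hE; clear; lia.
    by apply; move: i_mid hE; clear; lia.
  right; exists (f (path_pt x (path_len x - i))); split.
    have := Ep i.-1; rewrite E_sym /npar ifF; last by move: ile i0 hE; clear; lia.
    rewrite ifF; last by move: i_high ni' hE; clear; lia.
    rewrite (_ : path_len x - i.-1.+1 = path_len x - i); last by move: i0; clear; lia.
    by apply; move: i0 ile i_high hE; clear; lia.
  have := Ep (path_len x - i); rewrite E_sym /npar ifF; last by move: i0 hE; clear; lia.
  rewrite ifT; last by move: i_high hE; clear; lia.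
  rewrite (_ : path_len x - (path_len x - i) = i); last by move: ile; clear; lia.
  by apply; move: ni ile hE; clear; lia.
- right; exists (f (path_pt x (sc x).+2)); split=> //; rewrite pv.
  have hE : path_len x = 2 * sc x + 3 by [].
  have ih : 0 < (sc x).+1 <= path_len x by move: hE; clear; lia.
  rewrite E_sym; have := fE _ (pt_rt xP ih); rewrite parZ_path // /npar.
  rewrite ifF; last by move: hE; clear; lia.
  by rewrite leqnn (_ : path_len x - (sc x).+1 = (sc x).+2) //; move: hE; clear; lia.
Qed.

(** Depth no longer increases along the new tree. Path vertices other than the bottom are ranked by
    the depth of the top, then by their position [pos] in zigzag order. [rank_base] exceeds all
    positions, so what hangs from the path still comes after it. *)
Definition rank_base := 2 * S + 4.
Definition pos x i := if i <= (sc x).+1 then 2 * i else 2 * (path_len x - i.+1) + 1.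

Definition rk v :=
  if [pick x in Pl | [exists i : 'I_(path_len x), v == path_pt x i]] is Some x
  then rank_base * dep (path_pt x 0) + pos x (dep v - dep (path_pt x 0)) else rank_base * dep v.

Lemma rk_path x i : x \in Pl -> i < path_len x ->
  rk (path_pt x i) = rank_base * dep (path_pt x 0) + pos x i.
Proof.
move=> xP ih; rewrite /rk; case: pickP => [x'|/(_ x)]; last first.
  by rewrite xP /= => /existsP[]; exists (Ordinal ih).
case/andP => x'P /existsP[j /eqP E].
have [xx' _] := pt_inj xP x'P (ltnW ih) (ltnW (ltn_ord j)) E; rewrite -xx'.
by rewrite (pt_dep xP (ltnW ih)) addKn.
Qed.

Lemma pos_lt x i : x \in Pl -> i < path_len x -> pos x i < rank_base.
Proof.
move=> /sc_range/andP[_ sS]; rewrite /pos /path_len /rank_base; case: (leqP i (sc x).+1) => /=; move: sS; clear; lia.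
Qed.

Lemma rk_other v : {in Pl, forall x i, 0 < i < path_len x -> v != path_pt x i} ->
  rk v = rank_base * dep v.
Proof.
move=> vN; rewrite /rk; case: pickP => // x /andP[xP /existsP[[[|i] ih] /= /eqP vE]].
  by rewrite vE subnn /pos muln0 addn0.
by have := vN x xP i.+1; rewrite vE eqxx ih => /(_ isT).
Qed.

Lemma rk_leq v : rk v <= rank_base * dep v.
Proof.
rewrite /rk; case: pickP => // x /andP[xP /existsP[[i ih] /= /eqP->]].
rewrite (pt_dep xP (ltnW ih)) addKn mulnDr leq_add2l.
case: i ih => [|i] ih; first by rewrite /pos !muln0.
by apply: leq_trans (ltnW (pos_lt xP ih)) _; rewrite leq_pmulr.
Qed.

Lemma parZ_rk v : v != rt -> rk (parZ v) < rk v.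
Proof.
move=> vrt; have NS_gt0 : 0 < rank_base by rewrite /rank_base addn_gt0 orbT.
case: parZP => // [x i xP ih ->|x xP pv vn|none].
- have hE : path_len x = 2 * sc x + 3 by [].
  case/andP: (ih) => i0 ile.
  have [i_top|ni] := eqVneq i (path_len x).
    rewrite [X in _ < X]rk_other; last first.
      move=> x' x'P j /andP[j0 jh]; apply/eqP => E.
      have [xx' ij] := pt_inj xP x'P ile (ltnW jh) E.
      by move: jh; rewrite -ij i_top xx' ltnn.
    rewrite /npar i_top eqxx rk_path //; last by rewrite hE; clear; lia.
    rewrite /pos muln0 addn0 ltn_pmul2l // [X in _ < X](pt_dep xP (leqnn _)).
    by rewrite hE; clear; lia.
  have ilt : i < path_len x by rewrite ltn_neqAle ni.
  have nlt : npar x i < path_len x.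
    rewrite /npar (negPf ni); move: i0 ile hE; clear; case: (leqP i (sc x).+1) => /=; lia.
  rewrite !rk_path // ltn_add2l /npar (negPf ni) /pos.
  by move: i0 ilt hE; clear; case: (leqP i (sc x).+1) => ? ? ? ?;
    [rewrite ifF | rewrite ifT]; lia.
- have hE : path_len x = 2 * sc x + 3 by [].
  rewrite rk_path //; last by rewrite hE; clear; lia.
  rewrite rk_other; last first.
    move=> x' x'P j /andP[j0 jh]; apply: contraNneq vn => E.
    have xx' : x = x'.
      apply: (reg_inj xP x'P (kid_reg xP vrt pv)); rewrite E.
      by apply: pt_reg => //; exact: ltnW.
    rewrite -xx' in E jh.
    have := kid_dep xP vrt pv; rewrite E (pt_dep xP (ltnW jh)) => /addnI ->.
    by [].
  rewrite (kid_dep xP vrt pv) mulnDr ltn_add2l.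
  apply: leq_trans (pos_lt xP _) _; first by rewrite hE; clear; lia.
  by rewrite leq_pmulr.
- rewrite [X in _ < X]rk_other; last first.
    move=> x xP i /andP[i0 ih]; apply: contraNneq (none x xP) => ->.
    apply/orP; left; have i1 : i.-1 < path_len x by rewrite prednK // ltnW.
    by apply/existsP; exists (Ordinal i1); rewrite /= prednK.
  apply: leq_ltn_trans (rk_leq _) _; rewrite ltn_pmul2l //.
  by rewrite [X in _ < X]dep_par.
Qed.

(** A path vertex may keep its own children, take over those of [p_(s+1)], and gain two path
    vertices, namely its successor in zigzag order and, at the top, the bottom vertex. *)
Lemma parZ_children u : #|[set v | (v != rt) && (parZ v == u)]| <= 2 * b + 2.
Proof.
pose ch w := [set v | (v != rt) && (par v == w)].
case: (boolP [exists x in Pl, exists j : 'I_(path_len x).+1, u == path_pt x j]); last first.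
  rewrite negb_exists_in => /forall_inP none.
  have nopath x j : x \in Pl -> j <= path_len x -> u != path_pt x j.
    move=> xP jh; have := none x xP; rewrite negb_exists.
    by move/forallP/(_ (Ordinal (jh : j < (path_len x).+1))).
  apply: (@leq_trans b); last by clear; lia.
  apply: leq_trans (few_kids u); apply/subset_leq_card/subsetP => v.
  rewrite !inE => /andP[vrt]; rewrite vrt /=.
  case: parZP => // [x i xP ih vE|x xP pv vn] /eqP uE.
    by have := nopath x _ xP (npar_leq x i); rewrite uE eqxx.
  have := nopath x (sc x).+2 xP; rewrite uE eqxx => /(_ _)/negP[] //.
  by rewrite /path_len; clear; lia.
case/exists_inP => x xP /existsP[[j jh] /= /eqP uE].
apply: (@leq_trans #|ch u :|: ch (path_pt x (sc x).+1) :|: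
    [set path_pt x (path_len x - j); path_pt x (path_len x - j.+1)]|); last first.
  apply: leq_trans (leq_card_setU _ _) _.
  have le2 : #|[set path_pt x (path_len x - j); path_pt x (path_len x - j.+1)]| <= 2.
    by rewrite cards2; case: (_ != _).
  rewrite leq_add // mul2n -addnn; apply: leq_trans (leq_card_setU _ _) _.
  by rewrite leq_add ?few_kids.
apply/subset_leq_card/subsetP => v; rewrite inE => /andP[vrt].
case: parZP => // [x' i x'P ih vE|x' x'P pv vn|_] /eqP E.
- have [xx' ij] := pt_inj x'P xP (npar_leq x' i) (jh : j <= path_len x) (etrans E uE).
  rewrite xx' in vE ih ij; rewrite in_setU; apply/orP; right.
  rewrite !inE vE -ij /npar; case/andP: ih => i0 ile.
  case: (eqVneq i (path_len x)) => [->|ni]; first by rewrite subn0 eqxx.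
  case: (leqP i _) => _.
    by rewrite subKn // eqxx.
  by rewrite (_ : path_len x - (path_len x - i.+1).+1 = i) ?eqxx ?orbT //; move: ile ni; clear; lia.
- have hle : (sc x').+2 <= path_len x' by rewrite /path_len; clear; lia.
  have [xx' _] := pt_inj x'P xP hle (jh : j <= path_len x) (etrans E uE).
  by rewrite in_setU in_setU [X in _ || X || _]inE vrt -xx' pv eqxx /= orbT.
- by rewrite in_setU in_setU [X in X || _ || _]inE vrt -E eqxx.
Qed.

Definition inter x v := below v (path_pt x 1) && ~~ below v x.
(** Whatever hangs from inner path vertices is left out with them, so that [Z0] is closed under
    [parZ]. The bottom vertex stays, as it now hangs from the top. *)
Definition Z0 := [set v | [forall x in Pl, ~~ inter x v]].
Definition zigzag x j := if odd j then path_pt x (path_len x - (j./2).+1) else path_pt x j./2.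
Definition lf x := path_pt x (sc x).+1.
Let len x := (sc x).*2.+1.

Lemma below_pt x i j : x \in Pl -> i <= j <= path_len x -> below (path_pt x j) (path_pt x i).
Proof.
move=> xP /andP[ij jh]; have hx := cand_dep ((proj1 fam) x xP).
have -> : path_pt x i = iter (j - i) par (path_pt x j).
  by rewrite /path_pt -iterD; congr iter; move: ij jh; clear; lia.
apply: below_iter; rewrite pt_dep //; move: ij; clear; lia.
Qed.

Lemma inter_reg x v : x \in Pl -> inter x v -> v \in reg (sc x) x.
Proof.
move=> xP /andP[v1 vx]; apply: below_reg => //; apply: below_trans v1 _.
by apply: below_pt => //; rewrite /path_len; clear; lia.
Qed.

Lemma inter_pt x i : x \in Pl -> 0 < i < path_len x -> inter x (path_pt x i).
Proof.
move=> xP /andP[i0 ih]; apply/andP; split.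
  by apply: below_pt => //; rewrite i0 ltnW.
apply/negP => /below_dep; rewrite (end_dep xP) (pt_dep xP (ltnW ih)).
by move: ih; clear; lia.
Qed.

Lemma inter_pt0 x x' : x \in Pl -> x' \in Pl -> ~~ inter x' (path_pt x 0).
Proof.
move=> xP x'P; apply/negP => ix'.
have xx' := reg_inj xP x'P (pt_reg xP (leq0n _)) (inter_reg x'P ix').
case/andP: ix'; rewrite -xx' => /below_dep; rewrite (@pt_dep x 1) //.
  by move=> le _; move: le; clear; lia.
by rewrite /path_len; clear; lia.
Qed.

Lemma Z0P v : reflect {in Pl, forall x, ~~ inter x v} (v \in Z0).
Proof. by rewrite inE; exact: forall_inP. Qed.

Lemma Z0_rt : rt \in Z0.
Proof.
apply/Z0P => x xP; apply/negP => /andP[/below_dep].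
have h1 : 1 <= path_len x by rewrite /path_len; clear; lia.
by rewrite dep_rt pt_dep // addn1.
Qed.

Lemma Z0_parZ : {in Z0, forall v, v != rt -> parZ v \in Z0}.
Proof.
move=> v /Z0P vZ vrt; case: parZP => // [x i xP ih vE|x xP pv vn|none].
- have [i_top|ni] := eqVneq i (path_len x); last first.
    have := vZ x xP; rewrite vE inter_pt //.
    by move: ih ni; clear; lia.
  rewrite /npar i_top eqxx; apply/Z0P => x' x'P; exact: inter_pt0.
- case/negP: (vZ x xP); have s1 : 0 < (sc x).+1 < path_len x by rewrite /path_len; clear; lia.
  case/andP: (inter_pt xP s1) => b1 _; apply/andP; split.
    by apply: below_trans (below_par vrt) _; rewrite pv.
  apply/negP => /below_dep; rewrite (end_dep xP) (kid_dep xP vrt pv).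
  by rewrite /path_len; clear; lia.
- apply/Z0P => x xP; apply/negP => /andP[p1 px]; case/negP: (vZ x xP).
  apply/andP; split; first exact: below_trans (below_par vrt) p1.
  apply/negP => vx; have [E|vnx] := eqVneq v x.
    have := none x xP; rewrite /hit E negb_or => /andP[/existsP[]].
    have h1 : (path_len x).-1 < path_len x by rewrite /path_len; clear; lia.
    exists (Ordinal h1); rewrite /= prednK ?pt_end //.
    by rewrite /path_len; clear; lia.
  by rewrite below_parl in px.
Qed.

Lemma yy_idx x j : j < len x -> exists i, [/\ zigzag x j.+1 = path_pt x i, 0 < i < path_len x,
  i != (sc x).+1 & j.+1 = pos x i].
Proof.
rewrite /len /zigzag /pos /path_len => jl; have := odd_double_half j.+1.
case: (odd j.+1) => /= E.
  exists (2 * sc x + 3 - (uphalf j).+1); split=> //.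
  - by move: jl E; clear; lia.
  - by move: jl E; clear; lia.
  - by rewrite ifF; move: jl E; clear; lia.
exists (uphalf j); split=> //; try by move: jl E; clear; lia.
by rewrite ifT; move: jl E; clear; lia.
Qed.

Lemma yy_top : {in Pl, forall x, zigzag x 0 \in Z0}.
Proof. by move=> x xP; apply/Z0P => x' x'P; exact: inter_pt0. Qed.

Lemma yy_Z0 : {in Pl, forall x j, j < len x -> zigzag x j.+1 \notin Z0}.
Proof.
move=> x xP j /yy_idx[i [-> ih _ _]]; apply/negP => /Z0P/(_ x xP).
by rewrite inter_pt.
Qed.

Lemma lf_Z0 : {in Pl, forall x, lf x \notin Z0}.
Proof.
move=> x xP; apply/negP => /Z0P/(_ x xP); rewrite inter_pt //.
by rewrite /path_len; clear; lia.
Qed.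

Lemma yy_par : {in Pl, forall x j, j < len x -> parZ (zigzag x j.+1) = zigzag x j}.
Proof.
move=> x xP j jl; have hE : path_len x = 2 * sc x + 3 by [].
have := odd_double_half j; rewrite /zigzag /= uphalf_half; rewrite /len in jl.
case: (odd j) => /= E.
  rewrite parZ_path //; last by move: jl E hE; clear; lia.
  rewrite /npar ifF; last by move: jl E hE; clear; lia.
  by rewrite ifT; last by move: jl E hE; clear; lia.
rewrite add0n parZ_path //; last by move: jl E hE; clear; lia.
rewrite /npar ifF; last by move: jl E hE; clear; lia.
rewrite ifF; last by move: jl E hE; clear; lia.
by congr path_pt; move: jl E hE; clear; lia.
Qed.

Lemma lf_par : {in Pl, forall x, parZ (lf x) = zigzag x (len x)}.
Proof.
move=> x xP; have hE : path_len x = 2 * sc x + 3 by [].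
rewrite /lf parZ_path //; last by move: hE; clear; lia.
rewrite /npar ifF ?leqnn; last by move: hE; clear; lia.
rewrite /zigzag /len /= odd_double /= uphalf_double.
by congr path_pt; move: hE; clear; lia.
Qed.

Lemma yy_inj : {in Pl &, forall x x' j j', j < len x -> j' < len x' ->
  zigzag x j.+1 = zigzag x' j'.+1 -> x = x' /\ j = j'}.
Proof.
move=> x x' xP x'P j j' /yy_idx[i [-> /andP[_ ih] _ jE]].
move=> /yy_idx[i' [-> /andP[_ ih'] _ jE']] E.
have [xx' ii'] := pt_inj xP x'P (ltnW ih) (ltnW ih') E.
by split=> //; apply: succn_inj; rewrite jE jE' xx' ii'.
Qed.

Lemma top_inj : {in Pl &, injective (zigzag^~ 0)}.
Proof. by move=> x x' xP x'P /(pt_inj xP x'P (leq0n _) (leq0n _))[]. Qed.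

Lemma lf_inj : {in Pl &, injective lf}.
Proof.
by move=> x x' xP x'P /(pt_inj xP x'P)[] //; rewrite /path_len; clear; lia.
Qed.

Lemma lf_yy : {in Pl &, forall x x' j, j < len x' -> lf x != zigzag x' j.+1}.
Proof.
move=> x x' xP x'P j /yy_idx[i [-> /andP[_ ih] inx _]]; apply/eqP => E.
have [||xx' si] := pt_inj xP x'P _ _ E.
- by rewrite /path_len; clear; lia.
- exact: ltnW.
by move: inx; rewrite -si xx' eqxx.
Qed.

Lemma lf_leaf : {in Pl, forall x u, u != rt -> parZ u != lf x}.
Proof.
move=> x xP u urt; apply/eqP; case: parZP => // [x' i x'P ih uE|x' x'P pu un|none] E.
- have [||xx' si] := pt_inj x'P xP _ _ E.
  + exact: npar_leq.
  + by rewrite /path_len; clear; lia.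
  by have := npar_neq ih; rewrite si xx' eqxx.
- have [||xx' si] := pt_inj x'P xP _ _ E; try by rewrite /path_len; clear; lia.
  by move: si; rewrite xx'; clear; lia.
- by have := none x xP; rewrite /hit urt E eqxx orbT.
Qed.

End Zigzag.

End RootedTree.

(** * Rooting a tree *)

Section TreeRoot.

Variables (T : sgraph) (rt : T).
Hypothesis conn : forall u : T, connect (@adj T) rt u.
Hypothesis acyc : acyclic T.

Lemma has_walkP k (x z : T) :
  reflect (exists p, [/\ size p = k, path (@adj T) x p & last x p = z])
          (has_walk k x z).
Proof.
apply: (iffP existsP) => [[p /andP[pp /eqP pl]]|[p [ps pp pl]]].
  by exists p; rewrite size_tuple.
have ps' : size p == k by apply/eqP.
by exists (Tuple ps'); rewrite /= pp pl eqxx.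
Qed.

Lemma walk_exists u : exists k, has_walk k rt u.
Proof.
by have /connectP[p pp ->] := conn u; exists (size p); apply/has_walkP; exists p.
Qed.

Definition tdep u := ex_minn (walk_exists u).

Lemma tdep_walk u : has_walk (tdep u) rt u.
Proof. by rewrite /tdep; case: ex_minnP. Qed.

Lemma tdep_min k u : has_walk k rt u -> tdep u <= k.
Proof. by rewrite /tdep; case: ex_minnP => m _; apply. Qed.

Lemma tdep_rt : tdep rt = 0.
Proof.
by apply/eqP; rewrite -leqn0; apply: tdep_min; apply/has_walkP; exists [::].
Qed.

Definition tpar u := if u == rt then rt
  else if [pick v | adj v u && ((tdep v).+1 == tdep u)] is Some v then v else rt.

Lemma tparP u : u != rt -> adj (tpar u) u /\ tdep u = (tdep (tpar u)).+1.
Proof.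
move=> urt; rewrite /tpar (negPf urt); case: pickP => [v /andP[vu /eqP]//|none].
have /has_walkP[p [ps pp pl]] := tdep_walk u.
case/lastP: p => [|p v] in ps pp pl; first by rewrite -pl eqxx in urt.
rewrite last_rcons in pl; rewrite rcons_path pl in pp; case/andP: pp => pp ep.
have le1 : tdep (last rt p) <= size p.
  by apply: tdep_min; apply/has_walkP; exists p.
have le2 : tdep u <= (tdep (last rt p)).+1.
  have /has_walkP[q [qs qp ql]] := tdep_walk (last rt p).
  apply: tdep_min; apply/has_walkP; exists (rcons q u).
  by rewrite size_rcons qs rcons_path qp ql ep last_rcons.
have := none (last rt p); rewrite ep /= => /eqP[].
by rewrite size_rcons in ps; move: ps le1 le2; clear; lia.
Qed.

(** The edges to parents already connect [T]. Any other edge could be deleted without separating its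
    ends, and a path between them would close to a cycle. *)
Lemma tree_edge u v : adj u v ->
  (v != rt /\ tpar v = u) \/ (u != rt /\ tpar u = v).
Proof.
move=> uv.
case: (boolP ((v != rt) && (tpar v == u))) => [/andP[vrt /eqP]|nv]; first by left.
case: (boolP ((u != rt) && (tpar u == v))) => [/andP[urt /eqP]|nu]; first by right.
have unv : u != v by apply: contraTneq uv => ->; rewrite adj_irr.
pose e' : rel T := fun x y => adj x y &&
  ~~ [|| (x == u) && (y == v) | (x == v) && (y == u)].
have e'_sym : symmetric e'.
  by move=> x y; rewrite /e' adj_sym; congr (_ && ~~ _); rewrite orbC ![(_ == u) && _]andbC.
have con w : connect e' rt w.
  have [k] := ubnP (tdep w); elim: k => // k IHk in w *; rewrite ltnS => wk.
  have [->|wrt] := eqVneq w rt; first exact: connect0.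
  have [pw dw] := tparP wrt.
  apply: connect_trans (IHk (tpar w) _) (connect1 _); first by rewrite -dw.
  rewrite /e' pw /= negb_or !negb_and; apply/andP; split.
    have [wv|] := eqVneq w v; last by rewrite orbT.
    by move: nv; rewrite -wv wrt /= => ->.
  have [wu|] := eqVneq w u; last by rewrite orbT.
  by move: nu; rewrite -wu wrt /= => ->.
have /connectP[p0 pp0 pl0] : connect e' u v.
  apply: connect_trans (con v); rewrite (sym_connect_sym e'_sym); exact: con.
case/shortenP: pp0 pl0 => p pp up _ pl.
have sz : 1 < size p.
  case: p => [|x [|z p]] //= in pp up pl *.
    by rewrite pl eqxx in unv.
  by move: pp; rewrite /e' -pl !eqxx /= andbF.
exfalso; apply: (acyc (c := u :: p)) => //; apply/andP; split=> //.
rewrite /= rcons_path -pl adj_sym uv andbT.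
by apply: sub_path pp => x z /andP[].
Qed.

Lemma card_tree_kids Delta u : max_degree T <= Delta ->
  #|[set v | (v != rt) && (tpar v == u)]| <= Delta.
Proof.
move=> maxd; apply: leq_trans maxd; apply: leq_trans (leq_bigmax u).
apply/subset_leq_card/subsetP => v; rewrite !inE => /andP[vrt /eqP<-].
by have [] := tparP vrt.
Qed.

End TreeRoot.

Lemma square_adjP (G : sgraph) (x z : G) : x != z ->
  adj x z \/ (exists w, adj x w /\ adj w z) -> square_adj x z.
Proof.
move=> xz [xz'|[w [xw wz]]]; rewrite /square_adj ?xz' //.
case: (boolP (adj x z)) => //= nxz; apply/andP; split.
  by apply/has_walkP; exists [:: w; z]; rewrite /= xw wz.
apply/forallP => -[[|[|j]] //= _]; apply/negP => /has_walkP[p [ps pp pl]].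
  by case: p ps pp pl => //= _ _ E; rewrite E eqxx in xz.
case: p ps pp pl => [|a [|]] //= _; rewrite andbT => xa E.
by rewrite E (negPf nxz) in xa.
Qed.

(** * From the neighbourhood inequality to joined and extendable sets *)

Section Expansion.

Variables (V : finType) (e : rel V) (D t : nat).
Let n := #|V|.
Let m := (n %/ t).+1.
Hypothesis t_gt0 : 0 < t.
Hypothesis t_le : t <= n.
Hypothesis expand : forall X : {set V},
  t ^ 2 * n * #|X| <= #|nb e X| * (n + t ^ 2 * #|X|).

(** If [nb e X] missed [m] vertices, [expand] would give [m * t ^ 2 * #|X| <= n ^ 2], but
    [#|X| >= m] and [m * t > n]. *)
Lemma expansion_joined : joined e m.
Proof.
move=> X mX; rewrite ltnNge; apply/negP => le.
have := expand X; have lt : n < m * t := ltn_ceil n t_gt0.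
rewrite -[#|V|]/n in le.
move: (#|nb e X|) (#|X|) mX le lt; move: (n) (m); clear => n m M x mx le lt.
rewrite (expnS t 1) expn1 => H.
have H1 : M * (n + t * t * x) + m * (n + t * t * x) <= n * (n + t * t * x).
  by rewrite -mulnDl leq_mul2r le orbT.
have H2 : m * t * (m * t) <= m * (t * t * x).
  rewrite -!mulnA leq_mul2l; apply/orP; right.
  by rewrite leq_mul2l mulnC leq_mul2l mx !orbT.
have H3 : n * n < m * t * (m * t) by apply: ltn_mul.
have H4 : n * (t * t * x) = t * t * n * x by lia.
lia.
Qed.

(** Since [m * t <= 2 n], a set of at most [2 m] vertices has [n + t ^ 2 * #|X| <= 5 t n], and
    [expand] yields at least [t * #|X| / 5] neighbours. *)
Lemma expansion_extendable : 5 * D <= t -> extendable e D m set0 (fun=> 0).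
Proof.
move=> tD X mX; rewrite setD0; under eq_bigr do rewrite subn0.
rewrite sum_nat_const leqNgt; apply/negP => ltM.
have := expand X; have lt : m * t <= 2 * n.
  by rewrite /m mulSn mul2n -addnn leq_add // leq_trunc_div.
have n_gt0 : 0 < n := leq_trans t_gt0 t_le.
move: (#|nb e X|) (#|X|) mX ltM lt n_gt0 tD t_gt0; move: (n) (m); clear.
move=> n m M x mx ltM lt n_gt0 tD t_gt0; rewrite (expnS t 1) expn1 => H.
have H1 : t * t * x <= 4 * t * n.
  have : t * t * x <= t * t * m.*2 by rewrite leq_mul2l mx orbT.
  have : t * (m * t) <= t * (2 * n) by rewrite leq_mul2l lt orbT.
  by rewrite -mul2n; lia.
have H2 : M * (n + t * t * x) <= M * (5 * t * n).
  rewrite leq_mul2l; apply/orP; right.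
  have : n <= t * n by rewrite leq_pmull.
  lia.
have H3 : t * n * (t * x) <= t * n * (5 * M) by lia.
have H4 : t * x <= 5 * M by move: H3; rewrite leq_pmul2l // muln_gt0 t_gt0.
have H5 : 5 * D * x <= t * x by rewrite leq_mul2r tD orbT.
by lia.
Qed.

End Expansion.

(** * Choice of the constants *)

Section Constants.

Variable b : nat.

(** [growth] is the [beta ^ 3] of [place_family], and [demand] allows for [2 b + 2] children.
    [supply] is at least 6 and lets the places of scale 1 alone, [supply * g ^ S] in number, exceed
    [6 m + 4 g ^ S + 2 m D], as [m <= g ^ S]. Since [g ^ S <= g m] and [m * ratio <= 2 n], [ratio]
    ensures [2 * supply * g ^ (S + 1) < n]. *)
Definition growth := (b ^ 19) ^ 3.
Definition demand := growth + (2 * b + 2) + 5.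
Definition supply := 2 * demand + 11.
Definition ratio := 8 * supply * (growth * growth).

Hypothesis b_gt1 : 1 < b.

Lemma growth_gt1 : 1 < growth.
Proof. by rewrite /growth -expnM -(exp1n (19 * 3)) ltn_exp2r. Qed.

Lemma ratio_large : 5 * demand <= ratio.
Proof.
have := growth_gt1; rewrite /ratio /supply; move: growth demand => g D; clear; nia.
Qed.

Variables (G T : sgraph).
Hypothesis treeT : is_tree T.
Hypothesis cardTG : #|T| = #|G|.
Hypothesis maxT : max_degree T <= b.
Hypothesis G_large : ratio <= #|G|.
Hypothesis expand : forall X : {set G},
  ratio ^ 2 * #|G| * #|X| <= #|nb (@adj G) X| * (#|G| + ratio ^ 2 * #|X|).

Lemma square_contains_tree : contains_copy (square G) T.
Proof.
case: treeT => -[T_gt0 connT] acycT.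
have [rt _] : exists rt : T, rt \in T by apply/card_gt0P.
have conn : forall u : T, connect (@adj T) rt u by move=> u; exact: connT.
pose par := tpar conn; pose dep := tdep conn.
have dep_rt : dep rt = 0 := tdep_rt conn.
have dep_par u : u != rt -> dep u = (dep (par u)).+1.
  by move=> urt; have [] := tparP conn urt.
have kids u : #|[set v | (v != rt) && (par v == u)]| <= b.
  exact: card_tree_kids.
pose g := growth; pose D := demand; pose kap := supply.
have g_gt1 : 1 < g := growth_gt1; have g_gt0 := ltnW g_gt1.
have kap_gt0 : 0 < kap by rewrite /kap /supply addn_gt0 orbT.
have t_gt0 : 0 < ratio.
  by apply: leq_trans ratio_large; rewrite /demand; clear; lia.
pose m := (#|G| %/ ratio).+1; pose S := (trunc_log g m).+1.
have m_gt0 : 0 < m by [].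
have gS_ge : m <= g ^ S by apply: ltnW; exact: trunc_log_ltn.
have gS_le : g ^ S <= g * m.
  by rewrite /S expnS leq_mul2l trunc_logP ?orbT.
have mt : m * ratio <= 2 * #|G|.
  by rewrite /m mulSn mul2n -addnn leq_add // leq_trunc_div.
have large : 2 * kap * g ^ S.+1 < #|T|.
  rewrite cardTG expnS.
  have : 2 * kap * (g * g ^ S) <= 2 * kap * (g * (g * m)).
    by rewrite leq_mul2l leq_mul2l gS_le !orbT.
  move: mt; rewrite /ratio -/kap -/g.
  have : 0 < kap * (g * (g * m)).
    by rewrite muln_gt0; apply/andP; split=> //; rewrite muln_gt0; apply/andP;
       split=> //; rewrite muln_gt0; apply/andP.
  by move: (g ^ S) (#|G|); move: (m) (g) (kap); clear; lia.
have [Pl [sc [fam scr cnt]]] :=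
  @place_family T rt par dep b dep_rt dep_par kids b_gt1 g S kap
    (leqnn _) kap_gt0 large.
have join : joined (@adj G) m by exact: expansion_joined.
have ext0 : extendable (@adj G) D m set0 (fun=> 0).
  by apply: expansion_extendable; rewrite ?ratio_large.
have room0 : room G D m (4 * m).+1.
  move: large; rewrite /room cardTG expnS /kap /supply -/D.
  have : 1 * m <= g * g ^ S by apply: leq_mul => //; exact: ltnW.
  move: (g * g ^ S) m_gt0; move: (m) (D) #|G|; clear=> m' D' n q m0.
  by rewrite mul1n => le lt; nia.
have [A [cA [Aext cA2 Asmall Adom]]] :=
  dominating_set m_gt0 join (leq_trans (isT : 1 < 5) (leq_addl _ _)) ext0 room0.
have [] := @spanning_embedding G (@adj G) D m g (2 * b + 2) S (@adj_sym G)
  m_gt0 join g_gt1 (leqnn _) isT T rt (parZ rt par dep Pl sc)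
  (rk par dep Pl sc S) (parZ_rk dep_rt dep_par b_gt1 fam scr)
  (parZ_children dep_rt dep_par kids b_gt1 fam) Pl (Z0 par dep Pl sc) sc
  (zigzag par sc) (lf par sc) (Z0_rt dep_rt dep_par fam)
  (Z0_parZ dep_rt dep_par b_gt1 fam) (yy_top dep_rt dep_par b_gt1 fam)
  (yy_Z0 dep_rt dep_par fam) (lf_Z0 dep_rt dep_par fam)
  (yy_par dep_rt dep_par b_gt1 fam) (lf_par dep_rt dep_par b_gt1 fam)
  (yy_inj dep_rt dep_par b_gt1 fam) (top_inj dep_rt dep_par b_gt1 fam)
  (lf_inj dep_rt dep_par b_gt1 fam) (lf_yy dep_rt dep_par b_gt1 fam)
  (lf_leaf dep_rt dep_par b_gt1 fam) cardTG gS_ge _ _ A Asmall cA Aext cA2 Adom.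
- move=> s srange; apply: leq_trans (cnt s srange).
  by rewrite leq_mul2r /kap /supply; apply/orP; right; clear; lia.
- have := cnt 1 isT; rewrite subn1 /= => le1.
  have : #|[set x in Pl | sc x == 1]| <= #|Pl|.
    by apply/subset_leq_card/subsetP => x; rewrite inE => /andP[].
  have : m.*2 * D <= (g ^ S).*2 * D by rewrite leq_mul2r leq_double gS_ge orbT.
  move: le1 gS_ge m_gt0; rewrite /kap /supply -/D.
  move: (g ^ S) #|Pl| #|[set x in Pl | _]|.
  by move: (m) (D); clear; nia.
move=> F [injF eF]; exists F => // x y xy.
have near v : v != rt -> square_adj (F (par v)) (F v).
  move=> vrt; apply: square_adjP.
    apply/eqP => /injF pv; have := dep_par v vrt; rewrite pv.
    by move: (dep v); clear; lia.
  exact: (zigzag_near dep_rt dep_par b_gt1 fam (@adj_sym G) eF vrt).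
have [[yrt <-]|[xrt <-]] := tree_edge conn acycT xy; first exact: near.
rewrite /= square_adj_sym; exact: near.
Qed.

End Constants.

Import Order.TTheory GRing.Theory Num.Theory.
Local Open Scope ring_scope.

(** * Expansion from the spectrum *)

Section SpectralBound.

Local Open Scope sesquilinear_scope.

Lemma char_poly_conj (F : fieldType) n (P M : 'M[F]_n) : P \in unitmx ->
  char_poly (invmx P *m M *m P) = char_poly M.
Proof.
move=> Pu; rewrite /char_poly /char_poly_mx.
have VP : map_mx polyC (invmx P) *m map_mx polyC P = 1%:M.
  by rewrite -map_mxM mulVmx // map_mx1.
have -> : 'X%:M - map_mx polyC (invmx P *m M *m P) =
    map_mx polyC (invmx P) *m ('X%:M - map_mx polyC M) *m map_mx polyC P.
  rewrite mulmxBr mulmxBl !map_mxM; congr (_ - _).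
  by rewrite -mulmxA -scalar_mxC mulmxA VP mul1mx.
by rewrite !det_mulmx mulrAC -det_mulmx VP det1 mul1r.
Qed.

(** As the bound by [lambda] fails for [d], [d] can only be the head of [s], so it is a simple
    eigenvalue. In an orthonormal eigenbasis [u] has a single nonzero coordinate; [w] vanishes
    there, and its other coordinates are scaled by at most [lambda]. *)
Lemma spectral_bound (C : numClosedFieldType) n (A : 'M[C]_n) (d lambda : C)
    (s : seq C) (u w : 'rV[C]_n) :
  A \is normalmx -> char_poly A = \prod_(a <- s) ('X - a%:P) ->
  (forall a, a \in behead s -> `|a| <= lambda) -> ~~ (`|d| <= lambda) ->
  u != 0 -> u *m A = d *: u -> w *m u^t* = 0 ->
  \sum_j `|(w *m A) 0 j| ^+ 2 <= lambda ^+ 2 * \sum_j `|w 0 j| ^+ 2.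
Proof.
move=> Anorm cpA small dbig u0 uA wu.
have nrmE (v : 'rV[C]_n) : \sum_j `|v 0 j| ^+ 2 = (v *m v^t*) 0 0.
  by rewrite mxE; apply: eq_bigr => j _; rewrite normCK !mxE.
pose P := spectralmx A; pose D := spectral_diag A.
have Pu : P \is unitarymx := spectral_unitarymx A.
have AE : A = P^t* *m diag_mx D *m P.
  by rewrite -invmx_unitary //; apply/orthomx_spectralP.
have PPt : P *m P^t* = 1%:M by apply/unitarymxP.
have PtP : P^t* *m P = 1%:M by rewrite -invmx_unitary // mulVmx // unitarymx_unit.
pose z := w *m P^t*; pose y := u *m P^t*.
have yD i : y 0 i * D 0 i = d * y 0 i.
  have : y *m diag_mx D = d *: y.
    by rewrite /y scalemxAl -uA AE !mulmxA -(mulmxA _ P) PPt mulmx1.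
  by move=> /matrixP/(_ 0 i); rewrite mul_mx_diag !mxE.
have uE : u = y *m P by rewrite /y -mulmxA PtP mulmx1.
have wE : w = z *m P by rewrite /z -mulmxA PtP mulmx1.
have zy : z *m y^t* = 0.
  rewrite /z /y trmx_mul map_mxM map_trmx trmxK -map_mx_comp.
  by rewrite (map_mx_id (@conjCK _)) mulmxA -(mulmxA w) PtP mulmx1.
have wA : w *m A = z *m diag_mx D *m P by rewrite AE !mulmxA.
clearbody y z.
have [i0 yi0] : exists i, y 0 i != 0.
  apply/existsP; apply: contraNT u0; rewrite negb_exists => /forallP y0.
  suff y00 : y = 0 by rewrite uE y00 mul0mx.
  by apply/rowP => i; rewrite [RHS]mxE; apply/eqP; have := y0 i; rewrite negbK.
have Di0 : D 0 i0 = d by apply: (mulfI yi0); rewrite yD mulrC.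
have cpD : \prod_i ('X - (D 0 i)%:P) = \prod_(a <- s) ('X - a%:P).
  rewrite -cpA AE -invmx_unitary // char_poly_conj ?unitarymx_unit //.
  rewrite char_poly_trig ?diag_mx_is_trig //.
  by apply: eq_bigr => i _; rewrite mxE eqxx.
have [s' sE] : exists s', s = d :: s'.
  have : root (\prod_(a <- s) ('X - a%:P)) d.
    by rewrite -cpD (bigD1 i0) //= rootM Di0 root_XsubC eqxx.
  rewrite root_prod_XsubC; case: (s) small => // a s' /= small.
  rewrite inE => /orP[/eqP->|/small]; first by exists s'.
  by rewrite (negPf dbig).
have small' i : i != i0 -> `|D 0 i| <= lambda.
  move=> ii0; apply: small; rewrite sE /= -root_prod_XsubC.
  have := cpD; rewrite sE big_cons (bigD1 i0) //= Di0 => /(mulfI _) <-.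
    by rewrite (bigD1 i) //= rootM root_XsubC eqxx.
  by rewrite polyXsubC_eq0.
have y0 i : i != i0 -> y 0 i = 0.
  move=> ii0; apply/eqP; apply: contraNT dbig => yi.
  by rewrite -(_ : D 0 i = d) ?small' //; apply: (mulfI yi); rewrite yD mulrC.
have zi0 : z 0 i0 = 0.
  move: zy => /matrixP/(_ 0 0); rewrite !mxE (bigD1 i0) //= big1 => [|i ii0].
    rewrite !mxE addr0 => /eqP; rewrite mulf_eq0 conjC_eq0 (negPf yi0) orbF.
    by move/eqP.
  by rewrite !mxE y0 // conjC0 mulr0.
have unit_nrm (v : 'rV[C]_n) : \sum_j `|(v *m P) 0 j| ^+ 2 = \sum_j `|v 0 j| ^+ 2.
  by rewrite !nrmE trmx_mul map_mxM mulmxA -(mulmxA v) PPt mulmx1.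
rewrite wA wE !unit_nrm mulr_sumr; apply: ler_sum => i _.
rewrite mul_mx_diag !mxE; have [->|ii0] := eqVneq i i0.
  by rewrite zi0 mul0r normr0 expr0n mulr0.
rewrite normrM exprMn mulrC ler_wpM2r ?exprn_ge0 //.
by rewrite lerXn2r ?nnegrE ?small' // (le_trans (normr_ge0 _) (small' i ii0)).
Qed.
(** Over [R[i]] a real symmetric matrix is normal, and the inclusion of [R] respects order, norms
    and characteristic polynomials. *)
Lemma real_spectral_bound (R : rcfType) n (A : 'M[R]_n) (d lambda : R)
    (s : seq R) (u w : 'rV[R]_n) :
  A^T = A -> char_poly A = \prod_(a <- s) ('X - a%:P) ->
  (forall a, a \in behead s -> `|a| <= lambda) -> lambda < `|d| ->
  u != 0 -> u *m A = d *: u -> w *m u^T = 0 ->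
  \sum_j (w *m A) 0 j ^+ 2 <= lambda ^+ 2 * \sum_j w 0 j ^+ 2.
Proof.
move=> Asym cpA small dbig u0 uA wu.
pose f : {rmorphism R -> R[i]} := real_complex R.
have f_le x y : (f x <= f y) = (x <= y) := lecR x y.
have f_conj x : (f x)^* = f x.
  exact: conjc_real.
have f_norm x : `|f x| = f `|x|.
  have pos (x' : R) : 0 <= x' -> `|f x'| = f x'.
    by move=> x'0; apply: ger0_norm; rewrite -(rmorph0 f) f_le.
  have [x0|/ltW x0] := leP 0 x; first by rewrite pos // ger0_norm.
  by rewrite (ler0_norm x0) -[LHS]normrN -rmorphN pos ?oppr_ge0.
have f_sqr x : `|f x| ^+ 2 = f (x ^+ 2).
  by rewrite f_norm -rmorphXn /= real_normK ?num_real.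
have trC m p (M : 'M[R]_(m, p)) : (map_mx f M)^t* = map_mx f M^T.
  by apply/matrixP => i j; rewrite !mxE f_conj.
have sumE (v : 'rV[R]_n) : \sum_j `|map_mx f v 0 j| ^+ 2 = f (\sum_j v 0 j ^+ 2).
  by rewrite rmorph_sum; apply: eq_bigr => j _; rewrite mxE f_sqr.
rewrite -f_le rmorphM rmorphXn -!sumE map_mxM.
apply: (@spectral_bound _ _ _ (f d) _ (map f s) (map_mx f u)).
- by apply/normalmxP; rewrite trC Asym.
- by rewrite -map_char_poly cpA map_prod_XsubC big_map.
- move=> a; rewrite behead_map => /mapP[a' a's ->].
  by rewrite f_norm f_le small.
- by rewrite f_norm f_le -ltNge.
- by rewrite map_mx_eq0.
- by rewrite -map_mxM uA map_mxZ.
- by rewrite trC -map_mxM wu map_mx0.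
Qed.

End SpectralBound.

(** Cauchy-Schwarz, read off from the nonnegative sum of the squares of [#|S| * c i - T]. *)
Lemma sum_sqr_bound (R : realFieldType) (I : finType) (S : {set I}) (c : I -> R) :
  (\sum_(i in S) c i) ^+ 2 <= #|S|%:R * \sum_(i in S) c i ^+ 2.
Proof.
set T := \sum_(i in S) c i; set Q := \sum_(i in S) c i ^+ 2.
have [S0|S_gt0] := posnP #|S|.
  by rewrite /T (cards0_eq S0) big_set0 expr0n cards0 mul0r.
have : 0 <= \sum_(i in S) (#|S|%:R * c i - T) ^+ 2.
  by apply: sumr_ge0 => i _; exact: sqr_ge0.
have -> : \sum_(i in S) (#|S|%:R * c i - T) ^+ 2 =
    #|S|%:R ^+ 2 * Q - 2 * #|S|%:R * T * T + #|S|%:R * T ^+ 2.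
  rewrite (eq_bigr (fun i => #|S|%:R ^+ 2 * c i ^+ 2 - 2 * #|S|%:R * T * c i + T ^+ 2)).
    rewrite big_split sumrB -!mulr_sumr /= sumr_const -mulr_natl -/Q -/T; ring.
  by move=> i _; ring.
have S_pos : 0 < #|S|%:R :> R by rewrite ltr0n.
move=> ge0; rewrite -(ler_pM2l S_pos) -subr_ge0; apply: le_trans ge0 _.
by rewrite le_eqVlt; apply/orP; left; apply/eqP; ring.
Qed.

(** * Lower bound for neighbourhoods *)

Section NeighbourhoodBound.

Variables (R : realType) (G : sgraph) (n d : nat) (lambda : R).
Hypothesis ndlG : ndl_graph n d lambda G.
Hypothesis lambda_lt : lambda < d%:R.
Variable X : {set G}.

Let k : R := #|X|%:R.
Let N : R := n%:R.
Let c (x : G) : R := \sum_(y in X) (adj y x)%:R.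

Let cardG : #|G| = n. Proof. by case: ndlG. Qed.

Let sum_ord (F : G -> R) : \sum_(j < #|G|) F (enum_val j) = \sum_x F x.
Proof.
rewrite [RHS](reindex (@enum_val G G)) //; exact/onW_bij/enum_val_bij.
Qed.

Let sum_adj (x : G) : \sum_z (adj x z)%:R = d%:R :> R.
Proof.
case: ndlG => _ /(_ x) <- _; rewrite /degree -sum1_card natr_sum.
rewrite [RHS]big_mkcond; apply: eq_bigr => z _; rewrite inE.
by case: (adj x z).
Qed.

Let sum_c : \sum_x c x = d%:R * k.
Proof.
rewrite /c exchange_big /= (eq_bigr (fun=> d%:R)) => [|y _]; last exact: sum_adj.
by rewrite sumr_const mulr_natr.
Qed.

Let sum_ind : \sum_x (x \in X)%:R = k.
Proof.
rewrite /k -sum1_card natr_sum [RHS]big_mkcond /=.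
by apply: eq_bigr => x _; case: (x \in X).
Qed.

(** The adjacency matrix maps the indicator of [X] minus its mean [k / N] to [c - d k / N];
    subtracting the mean makes it orthogonal to the constant eigenvector of [d]. *)
Let deviation : (0 < n)%N ->
  \sum_x (c x - d%:R * k / N) ^+ 2 <= lambda ^+ 2 * \sum_x ((x \in X)%:R - k / N) ^+ 2.
Proof.
move=> n_gt0; have N0 : N != 0 by rewrite pnatr_eq0 -lt0n.
case: ndlG => _ _ [s [_ cpA] small].
pose u : 'rV[R]_#|G| := const_mx 1.
pose w : 'rV[R]_#|G| := \row_j ((enum_val j \in X)%:R - k / N).
have uA : u *m adj_mx R G = d%:R *: u.
  apply/rowP => j; rewrite !mxE mulr1 -(sum_adj (enum_val j)) -sum_ord.
  by apply: eq_bigr => i _; rewrite !mxE mul1r adj_sym.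
have wA j : (w *m adj_mx R G) 0 j = c (enum_val j) - d%:R * k / N.
  rewrite mxE (eq_bigr (fun i => (enum_val i \in X)%:R * (adj (enum_val i) (enum_val j))%:R
     - k / N * (adj (enum_val i) (enum_val j))%:R)); last first.
    by move=> i _; rewrite !mxE mulrBl.
  rewrite sumrB -mulr_sumr; congr (_ - _).
    rewrite (sum_ord (fun x => (x \in X)%:R * (adj x (enum_val j))%:R)).
    rewrite /c [RHS]big_mkcond; apply: eq_bigr => x _.
    by case: (x \in X); rewrite ?mul1r ?mul0r.
  rewrite (sum_ord (fun x => (adj x (enum_val j))%:R)).
  under eq_bigr do rewrite adj_sym.
  by rewrite sum_adj mulrC mulrA.
have -> : \sum_x (c x - d%:R * k / N) ^+ 2 = \sum_j (w *m adj_mx R G) 0 j ^+ 2.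
  rewrite -(sum_ord (fun x => (c x - d%:R * k / N) ^+ 2)).
  by apply: eq_bigr => j _; rewrite wA.
have -> : \sum_x ((x \in X)%:R - k / N) ^+ 2 = \sum_j w 0 j ^+ 2.
  rewrite -(sum_ord (fun x => ((x \in X)%:R - k / N) ^+ 2)).
  by apply: eq_bigr => j _; rewrite mxE.
apply: (@real_spectral_bound _ _ _ d%:R _ s u) => //.
- by apply/matrixP => i j; rewrite !mxE adj_sym.
- by rewrite ger0_norm.
- have G_gt0 : (0 < #|G|)%N by rewrite cardG.
  apply/eqP => /rowP/(_ (Ordinal G_gt0)); rewrite !mxE => /eqP.
  by rewrite oner_eq0.
- apply/matrixP => i j; rewrite !mxE.
  under eq_bigr do rewrite !mxE mulr1.
  rewrite (sum_ord (fun x => (x \in X)%:R - k / N)) sumrB sum_ind sumr_const.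
  by rewrite cardG -mulr_natr -/N mulfVK // subrr.
Qed.

(** [c] is supported on the neighbourhood and sums to [d k], so Cauchy-Schwarz bounds the size of
    the support from below by [(d k) ^ 2 / Q], while [deviation] gives
    [Q <= d ^ 2 k ^ 2 / N + lambda ^ 2 k]. *)
Lemma neighbourhood_bound :
  d%:R ^+ 2 * k ^+ 2 * N <= #|nb (@adj G) X|%:R * (d%:R ^+ 2 * k ^+ 2 + lambda ^+ 2 * N * k).
Proof.
have [n0|n_gt0] := posnP n.
  have -> : N = 0 by rewrite /N n0.
  have -> : k = 0.
    have : (#|X| <= #|G|)%N := max_card _.
    by rewrite /k cardG n0 leqn0 => /eqP->.
  by rewrite !mulr0 expr0n mulr0 addr0 mulr0.
have N_gt0 : 0 < N by rewrite ltr0n.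
have N0 : N != 0 by rewrite gt_eqF.
pose Q := \sum_x c x ^+ 2.
have dev := deviation n_gt0.
have E1 : \sum_x (c x - d%:R * k / N) ^+ 2 = Q - d%:R ^+ 2 * k ^+ 2 / N.
  rewrite (eq_bigr (fun x => c x ^+ 2 - 2 * (d%:R * k / N) * c x + (d%:R * k / N) ^+ 2)).
    rewrite big_split sumrB -mulr_sumr /= sum_c sumr_const cardG -mulr_natr -/N -/Q.
    by field.
  by move=> x _; ring.
have E2 : \sum_x ((x \in X)%:R - k / N) ^+ 2 = k - k ^+ 2 / N.
  rewrite (eq_bigr (fun x => (x \in X)%:R - 2 * (k / N) * (x \in X)%:R + (k / N) ^+ 2)).
    rewrite big_split sumrB -mulr_sumr /= sum_ind sumr_const cardG -mulr_natr -/N.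
    by field.
  by move=> x _; case: (x \in X) => /=; ring.
have Q_le : Q * N <= d%:R ^+ 2 * k ^+ 2 + lambda ^+ 2 * N * k.
  rewrite E1 E2 in dev.
  have : (Q - d%:R ^+ 2 * k ^+ 2 / N) * N <= lambda ^+ 2 * (k - k ^+ 2 / N) * N.
    by rewrite ler_pM2r.
  have -> : (Q - d%:R ^+ 2 * k ^+ 2 / N) * N = Q * N - d%:R ^+ 2 * k ^+ 2 by field.
  have -> : lambda ^+ 2 * (k - k ^+ 2 / N) * N =
      lambda ^+ 2 * N * k - (lambda * k) ^+ 2 by field.
  by move=> le1; have := sqr_ge0 (lambda * k); lra.
have c_nb x : x \notin nb (@adj G) X -> c x = 0.
  move=> xX; rewrite /c big1 // => y yX; case: (boolP (adj y x)) => // yx.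
  by case/negP: xX; apply/nbP; exists y.
have sum_nb (F : R -> R) : F 0 = 0 ->
    \sum_(x in nb (@adj G) X) F (c x) = \sum_x F (c x).
  move=> F0; rewrite [LHS]big_mkcond; apply: eq_bigr => x _.
  by case: ifPn => // /c_nb->.
have := sum_sqr_bound (nb (@adj G) X) c.
rewrite (sum_nb id) // (sum_nb (fun z => z ^+ 2)) ?expr0n // sum_c -/Q => CS.
apply: le_trans (ler_wpM2l (ler0n R #|nb (@adj G) X|) Q_le).
by rewrite [X in _ <= X]mulrA ler_pM2r // -exprMn.
Qed.

End NeighbourhoodBound.

Lemma ndl_expansion (R : realType) (G : sgraph) (n d t : nat) (lambda : R) :
  ndl_graph n d lambda G -> (1 < t)%N -> 0 < lambda -> t%:R * lambda <= d%:R ->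
  forall X : {set G},
    (t ^ 2 * #|G| * #|X| <= #|nb (@adj G) X| * (#|G| + t ^ 2 * #|X|))%N.
Proof.
move=> ndl t_gt1 lam_gt0 le_d X.
have lam_lt : lambda < d%:R.
  apply: lt_le_trans le_d; rewrite ltr_pMl // ltr1n //.
have d_gt0 : 0 < d%:R :> R by exact: lt_trans lam_lt.
have := neighbourhood_bound ndl lam_lt X; have [<- _ _] := ndl.
rewrite -(ler_nat R) !(natrM, natrD, natrX).
have [->|X_gt0] := posnP #|X|.
  by move=> _; rewrite mulr0n !mulr0 addr0 mulr_ge0.
have k_gt0 : 0 < #|X|%:R :> R by rewrite ltr0n.
move: (#|X|%:R : R) (#|G|%:R : R) (#|nb (@adj G) X|%:R : R) (ler0n R #|G|)
  (ler0n R #|nb (@adj G) X|) k_gt0 => k N M N0 M0 k_gt0 H.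
have sq : t%:R ^+ 2 * lambda ^+ 2 <= d%:R ^+ 2.
  by rewrite -exprMn lerXn2r ?nnegrE ?mulr_ge0 // ltW.
have dk_gt0 : 0 < d%:R ^+ 2 * k by rewrite mulr_gt0 ?exprn_gt0.
(* After multiplication by [d ^ 2 * k], [t ^ 2 * lambda ^ 2 <= d ^ 2] can be used without
   division. *)
rewrite -(ler_pM2l dk_gt0).
have H1 : t%:R ^+ 2 * (d%:R ^+ 2 * k ^+ 2 * N) <=
    t%:R ^+ 2 * (M * (d%:R ^+ 2 * k ^+ 2 + lambda ^+ 2 * N * k)).
  by apply: ler_wpM2l => //; exact: exprn_ge0.
have H2 : (M * N * k) * (t%:R ^+ 2 * lambda ^+ 2) <= (M * N * k) * d%:R ^+ 2.
  by apply: ler_wpM2l => //; rewrite !mulr_ge0 // ltW.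
have -> : d%:R ^+ 2 * k * (t%:R ^+ 2 * N * k) = t%:R ^+ 2 * (d%:R ^+ 2 * k ^+ 2 * N).
  by ring.
apply: le_trans H1 _.
have -> : t%:R ^+ 2 * (M * (d%:R ^+ 2 * k ^+ 2 + lambda ^+ 2 * N * k)) =
  M * t%:R ^+ 2 * d%:R ^+ 2 * k ^+ 2 + (M * N * k) * (t%:R ^+ 2 * lambda ^+ 2) by ring.
have -> : d%:R ^+ 2 * k * (M * (N + t%:R ^+ 2 * k)) =
  M * t%:R ^+ 2 * d%:R ^+ 2 * k ^+ 2 + (M * N * k) * d%:R ^+ 2 by ring.
by rewrite lerD2l.
Qed.

Theorem theorem1p5 (R : realType) (Delta : nat) :
  exists2 C : R, 0 < C &
    exists d0 : nat, forall d : nat, (d0 <= d)%N ->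
      forall (n : nat) (lambda : R) (G : sgraph),
        ndl_graph n d lambda G -> C <= d%:R / lambda ->
        forall T : sgraph,
          is_tree T -> #|T| = n -> (max_degree T <= Delta)%N ->
          contains_copy (square G) T.
Proof.
pose b := maxn Delta 2; pose t := ratio b.
have b_gt1 : (1 < b)%N by rewrite leq_maxr.
have t_gt1 : (1 < t)%N.
  apply: leq_trans (ratio_large b_gt1); rewrite /demand; clear; lia.
have t_pos : 0 < t%:R :> R by rewrite ltr0n ltnW.
(* The same [t] serves as [C] and as [d0]: a vertex has [d >= t] neighbours, whence [t <= #|G|]. *)
exists t%:R => //; exists t => d le_d n lambda G ndl C_le T treeT cardT maxT.
have ratio_pos : 0 < d%:R / lambda := lt_le_trans t_pos C_le.
(* For [lambda <= 0] the quotient is not positive; for [lambda = 0] it is 0 by convention. *)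
have lam_gt0 : 0 < lambda.
  rewrite ltNge; apply/negP => lam_le0; move: ratio_pos; rewrite ltNge => /negP[].
  by rewrite mulr_ge0_le0 // invr_le0.
have le_tl : t%:R * lambda <= d%:R by rewrite -ler_pdivlMr.
have [cardG regG _] := ndl.
have [[T_gt0 _] _] := treeT.
have n_large : (t <= #|G|)%N.
  have /card_gt0P[x _] : (0 < #|G|)%N by rewrite cardG -cardT.
  by apply: leq_trans le_d _; rewrite -(regG x); exact: max_card.
apply: (square_contains_tree b_gt1 treeT _ _ n_large).
- by rewrite cardT cardG.
- by apply: leq_trans maxT _; rewrite leq_maxl.
- exact: ndl_expansion ndl t_gt1 lam_gt0 le_tl.
Qed.
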